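(* Consider the SBMD method described in the context with uniform probabilities $p_1=\dots=p_b=1/b$. Suppose $f$ is strongly convex with modulus $\mu>0$, i.e. $f(y)\ge f(x)+\langle g(x),y-x\rangle+\frac\mu2\|y-x\|^2$ for all $x,y\in X$, and that $V_i(z,x)\le\frac Q2\|z-x\|_i^2$ for all $z,x\in X_i$, $i=1,\dots,b$, for some $Q>0$. Suppose the stepsizes satisfy $\gamma_k\le\frac{bQ}{\mu}$ and the weights are $\theta_k=\gamma_k/\Gamma_k$, where $\Gamma_1=1$ and $\Gamma_k=\Gamma_{k-1}\left(1-\frac{\gamma_k\mu}{bQ}\right)$ for $k\ge2$. Then for any $N\ge1$ and $x\in X$, \[ \mathbb{E}[f(\bar x_N)-f(x)]\le\left(\sum_{k=1}^N\theta_k\right)^{-1}\left[\left(b-\frac{\gamma_1\mu}{Q}\right)\sum_{i=1}^bV_i(x_1^{(i)},x^{(i)})+\frac12\sum_{k=1}^N\gamma_k\theta_k\sum_{i=1}^bM_i^2\right]. \]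
   Context: Block structure: for $i=1,\dots,b$, $X_i\subseteq\mathbb{R}^{n_i}$ is a nonempty closed convex set, $X=X_1\times\cdots\times X_b\subseteq\mathbb{R}^n$. Each $\mathbb{R}^{n_i}$ carries a norm $\|\cdot\|_i$ with dual $\|\cdot\|_{i,*}$; $U_i\in\mathbb{R}^{n\times n_i}$ satisfy $(U_1,\dots,U_b)=I_n$, $x^{(i)}:=U_i^Tx$, and $\|x\|^2:=\sum_{i=1}^b\|x^{(i)}\|_i^2$. Problem: $f(x)=\mathbb{E}[F(x,\xi)]$ is convex on $X$. A stochastic oracle returns $G(x,\xi)$ with $\mathbb{E}[G(x,\xi)]=g(x)\in\partial f(x)$ for all $x\in X$; $G_i=U_i^TG$ and $\mathbb{E}[\|G_i(x,\xi)\|_{i,*}^2]\le M_i^2$ for all $x\in X$. Prox setup: $\omega_i:X_i\to\mathbb{R}$ continuously differentiable, 1-strongly convex w.r.t. $\|\cdot\|_i$; $V_i(z,x)=\omega_i(x)-\omega_i(z)-\langle\nabla\omega_i(z),x-z\rangle$; $P_i(v,y,\gamma)=\arg\min_{u\in X_i}\{\langle y,u\rangle+\frac1\gamma V_i(v,u)\}$. SBMD method: given $x_1\in X$, stepsizes $\gamma_k>0$, weights $\theta_k$, probabilities $p_i$; $\xi_1,\xi_2,\dots$ i.i.d. copies of $\xi$ and $i_1,i_2,\dots$ i.i.d. with $\mathrm{Prob}(i_k=i)=p_i$, independent of the $\xi_k$. For $k=1,\dots,N$: $x_{k+1}^{(i_k)}=P_{i_k}(x_k^{(i_k)},G_{i_k}(x_k,\xi_k),\gamma_k)$,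 $x_{k+1}^{(i)}=x_k^{(i)}$ for $i\ne i_k$. Output $\bar x_N=\left(\sum_{k=1}^N\theta_k\right)^{-1}\sum_{k=1}^N\theta_kx_k$. Expectations are w.r.t. $\{i_k\},\{\xi_k\}$. *)

(* Defs.v *)
From HB Require Import structures.
From mathcomp Require Import all_boot all_order all_algebra.
From mathcomp Require Import all_classical all_reals all_analysis.
Import Order.TTheory GRing.Theory Num.Theory.
Import numFieldNormedType.Exports.

Set Implicit Arguments.
Unset Strict Implicit.
Unset Printing Implicit Defensive.

Local Open Scope classical_set_scope.
Local Open Scope ring_scope.

Definition dotv (R : realType) (m : nat) (u v : 'rV[R]_m) : R :=
  \sum_(j < m) u 0 j * v 0 j.

Definition is_norm (R : realType) (m : nat) (N : 'rV[R]_m -> R) : Prop :=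
  [/\ (forall x, 0 <= N x),
      (forall x, N x = 0 -> x = 0),
      (forall (a : R) x, N (a *: x) = `|a| * N x) &
      (forall x y, N (x + y) <= N x + N y)].

Definition dual_norm (R : realType) (m : nat) (N : 'rV[R]_m -> R)
  (y : 'rV[R]_m) : R :=
  sup [set dotv y x | x in [set x | N x <= 1]].

Definition is_convex_set (R : realType) (m : nat) (A : set 'rV[R]_m) : Prop :=
  forall x y (t : R), A x -> A y -> 0 <= t <= 1 ->
    A (t *: x + (1 - t) *: y).

Definition convex_on (R : realType) (m : nat) (A : set 'rV[R]_m)
  (h : 'rV[R]_m -> R) : Prop :=
  forall x y (t : R), A x -> A y -> 0 <= t <= 1 ->
    h (t *: x + (1 - t) *: y) <= t * h x + (1 - t) * h y.

Definition strongly_convex_on (R : realType) (m : nat) (A : set 'rV[R]_m)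
  (N : 'rV[R]_m -> R) (c : R) (h : 'rV[R]_m -> R) : Prop :=
  forall x y (t : R), A x -> A y -> 0 <= t <= 1 ->
    h (t *: x + (1 - t) *: y)
      <= t * h x + (1 - t) * h y - c / 2 * t * (1 - t) * N (x - y) ^+ 2.

Definition C1_on (R : realType) (m : nat) (A : set 'rV[R]_m)
  (w : 'rV[R]_m -> R) : Prop :=
  (forall x, A x -> differentiable w x) /\
  (forall h : 'rV[R]_m, {within A, continuous (fun x => 'd w x h)}).

Definition bregman (R : realType) (m : nat) (w : 'rV[R]_m -> R)
  (z x : 'rV[R]_m) : R :=
  w x - w z - 'd w z (x - z).

Definition is_argmin (R : realType) (m : nat) (A : set 'rV[R]_m)
  (phi : 'rV[R]_m -> R) (u : 'rV[R]_m) : Prop :=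
  A u /\ forall v, A v -> phi u <= phi v.

Definition blk (R : realType) (b : nat) (nb : 'I_b -> nat)
  (x : 'rV[R]_(\sum_(i < b) nb i)) (i : 'I_b) : 'rV[R]_(nb i) :=
  submxrow x i.

Definition in_prod (R : realType) (b : nat) (nb : 'I_b -> nat)
  (Xs : forall i : 'I_b, set 'rV[R]_(nb i))
  (x : 'rV[R]_(\sum_(i < b) nb i)) : Prop :=
  forall i, Xs i (blk x i).

Definition blk_norm2 (R : realType) (b : nat) (nb : 'I_b -> nat)
  (Ns : forall i : 'I_b, 'rV[R]_(nb i) -> R)
  (x : 'rV[R]_(\sum_(i < b) nb i)) : R :=
  \sum_(i < b) Ns i (blk x i) ^+ 2.

(** Row vector built from a tuple (used to state joint measurability). *)
Definition row_of_tuple (R : realType) (n : nat) (t : n.-tuple R) : 'rV[R]_n :=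
  \row_(j < n) tnth t j.

(** Gamma_1 = 1, Gamma_k = Gamma_{k-1} (1 - gamma_k c) for k >= 2
    (here c = mu / (b Q)); Gamma_0 is unused. *)
Fixpoint Gam (R : realType) (c : R) (gam : nat -> R) (k : nat) : R :=
  match k with
  | 0 | 1 => 1
  | k'.+1 => Gam c gam k' * (1 - gam k'.+1 * c)
  end.

Definition indep_family (R : realType) (d dX : measure_display)
  (Omega : measurableType d) (Xi : measurableType dX) (b : nat)
  (P : probability Omega R) (ik : nat -> Omega -> 'I_b)
  (xi : nat -> Omega -> Xi) : Prop :=
  forall (s : seq nat) (A : nat -> set 'I_b) (B : nat -> set Xi),
    uniq s -> all (fun k => 0 < k)%N s -> (forall k, measurable (B k)) ->
    P (\bigcap_(k in [set` s]) (ik k @^-1` A k `&` xi k @^-1` B k))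
    = (\prod_(k <- s) (P (ik k @^-1` A k) * P (xi k @^-1` B k)))%E.

(* Main.v *)
Require Import Defs.
From HB Require Import structures.
From mathcomp Require Import all_boot all_order all_algebra.
From mathcomp Require Import all_classical all_reals all_analysis.
From mathcomp Require Import measurable_realfun ring lra zify.
Import Order.TTheory GRing.Theory Num.Theory.
Import numFieldNormedType.Exports.
Local Open Scope classical_set_scope.
Local Open Scope ring_scope.

Set Implicit Arguments.
Unset Strict Implicit.
Unset Printing Implicit Defensive.

(* Write Phi_k for the sum over the blocks of V_i(x_k^(i), x^(i)). The prox inequality
   bounds Phi_(k+1) by Phi_k plus the contribution psi_(i_k) of the block that moves.
   Since b 1_{i_k = i} has mean 1 given the past, b psi_(i_k) equals
   - gamma_k <g(x_k), x_k - x> plus a noise term whose mean is at most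
   gamma_k^2 / 2 sum_i M_i^2. Strong convexity together with V_i <= Q/2 ||.||_i^2 then gives
     gamma_k (f(x_k) - f(x)) <= b (1 - gamma_k mu / (b Q)) Phi_k - b Phi_(k+1) + noise_k,
   which telescopes after division by Gamma_k, and convexity of f passes to the average.
   The inequality is pointwise in omega up to the noise terms, so that f and the V_i need
   not be measurable. The mean of the noise is computed by Fubini: x_k is measurable for
   the history sigma-algebra, because a prox point is a Lipschitz function of
   gamma_k G_i - grad omega_i, and the pair (i_k, xi_k) is independent of the history. *)

(** * Norms on row vectors *)

Section Dotv.
Context {R : realType} {m : nat}.
Implicit Types u v w : 'rV[R]_m.

Lemma dotvC u v : dotv u v = dotv v u.
Proof. by apply: eq_bigr => j _; rewrite mulrC. Qed.

Lemma dotvDr u v w : dotv u (v + w) = dotv u v + dotv u w.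
Proof. by rewrite -big_split; apply: eq_bigr => j _; rewrite mxE mulrDr. Qed.

Lemma dotvZr a u v : dotv u (a *: v) = a * dotv u v.
Proof. by rewrite mulr_sumr; apply: eq_bigr => j _; rewrite mxE mulrCA. Qed.

Lemma dotvNr u v : dotv u (- v) = - dotv u v.
Proof. by rewrite -scaleN1r dotvZr mulN1r. Qed.

Lemma dotvBr u v w : dotv u (v - w) = dotv u v - dotv u w.
Proof. by rewrite dotvDr dotvNr. Qed.

Lemma dotvDl u v w : dotv (u + v) w = dotv u w + dotv v w.
Proof. by rewrite dotvC dotvDr !(dotvC w). Qed.

Lemma dotvZl a u v : dotv (a *: u) v = a * dotv u v.
Proof. by rewrite dotvC dotvZr dotvC. Qed.

Lemma dotvNl u v : dotv (- u) v = - dotv u v.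
Proof. by rewrite dotvC dotvNr dotvC. Qed.

Lemma dotvBl u v w : dotv (u - v) w = dotv u w - dotv v w.
Proof. by rewrite dotvDl dotvNl. Qed.

Lemma dotv0r u : dotv u 0 = 0.
Proof. by rewrite -(scale0r 0) dotvZr mul0r. Qed.

Lemma mx_norm_coord u j : `|u 0 j| <= `|u|.
Proof.
rewrite [leRHS]/Num.norm /= mx_normrE.
exact: (@le_bigmax _ _ _ 0 (fun ij : 'I_1 * 'I_m => `|u ij.1 ij.2|) (0, j)).
Qed.

Lemma mx_norm_lt u e : 0 < e -> (forall j, `|u 0 j| < e) -> `|u| < e.
Proof.
move=> e0 ue; rewrite [ltLHS]/Num.norm /= mx_normrE.
by apply/bigmax_ltP; split => // -[i j] _ /=; rewrite ord1.
Qed.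

Lemma dotv_le u v : `|dotv u v| <= m%:R * (`|u| * `|v|).
Proof.
apply: (le_trans (ler_norm_sum _ _ _)).
apply: (@le_trans _ _ (\sum_(j < m) `|u| * `|v|)).
  by apply: ler_sum => j _; rewrite normrM ler_pM // mx_norm_coord.
by rewrite sumr_const card_ord mulr_natl.
Qed.

End Dotv.

Section Norms.
Context {R : realType} {m : nat} (N : 'rV[R]_m -> R) (HN : is_norm N).
Implicit Types u v y : 'rV[R]_m.

Lemma is_norm_ge0 u : 0 <= N u. Proof. by case: HN. Qed.

Lemma is_normZ a u : N (a *: u) = `|a| * N u. Proof. by case: HN. Qed.

Lemma is_normD u v : N (u + v) <= N u + N v. Proof. by case: HN. Qed.

Lemma is_norm0 : N 0 = 0.
Proof. by rewrite -(scale0r 0) is_normZ normr0 mul0r. Qed.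

Lemma is_normN u : N (- u) = N u.
Proof. by rewrite -scaleN1r is_normZ normrN1 mul1r. Qed.

Lemma is_norm_distC u v : N (u - v) = N (v - u).
Proof. by rewrite -is_normN opprB. Qed.

Lemma is_norm_le_mx : exists2 C, 0 < C & forall u, N u <= C * `|u|.
Proof.
exists (1 + \sum_(j < m) N (delta_mx 0 j)).
  by rewrite ltr_pwDl// sumr_ge0// => j _; exact: is_norm_ge0.
move=> u; rewrite {1}(row_sum_delta u).
have N_sum (s : seq 'I_m) (h : 'I_m -> 'rV[R]_m) :
    N (\sum_(j <- s) h j) <= \sum_(j <- s) N (h j).
  elim: s => [|j s IH]; first by rewrite !big_nil is_norm0.
  by rewrite !big_cons (le_trans (is_normD _ _))// lerD2l.
apply: (le_trans (N_sum _ _)).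
rewrite mulrDl mul1r ler_wpDl// mulr_suml ler_sum// => j _.
by rewrite is_normZ mulrC ler_wpM2l ?is_norm_ge0// mx_norm_coord.
Qed.

Lemma is_norm_dist u v : `|N u - N v| <= N (u - v).
Proof.
rewrite ler_norml; apply/andP; split.
  by rewrite lerNl opprB lerBlDr is_norm_distC -{1}(subrK u v) is_normD.
by rewrite lerBlDr -{1}(subrK v u) is_normD.
Qed.

Lemma is_norm_continuous : continuous (N : 'rV[R]_m -> R).
Proof.
have [C C0 NC] := is_norm_le_mx.
move=> u P /nbhs_ballP[e /= e0 eP]; apply/nbhs_ballP.
exists (C^-1 * e); first by rewrite /= mulr_gt0// invr_gt0.
move=> v; rewrite -ball_normE /= => uv; apply: eP.
rewrite -ball_normE /=; apply: (le_lt_trans (is_norm_dist _ _)).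
by apply: (le_lt_trans (NC _)); rewrite -ltr_pdivlMl.
Qed.

(** On the unit sphere of the max norm, which is compact, the continuous function [N] attains a
    minimum, and definiteness makes it positive. Homogeneity extends the bound to all vectors. *)
Lemma mx_norm_le : exists2 C, 0 < C & forall u, `|u| <= C * N u.
Proof.
pose S : set 'rV[R]_m := [set u | `|u| = 1].
have cS : compact S.
  apply: bounded_closed_compact.
    by exists 1; split => // c c1 u /= ->; rewrite ltW.
  rewrite (_ : S = (fun u : 'rV[R]_m => `|u|) @^-1` [set 1])//.
  apply: preimage_closed; last exact: closed_eq.
  by move=> u _; exact: norm_continuous.
(* If the sphere is empty then every vector is 0, since a nonzero one could be normalised; the
   constant 1 then works. *)
have [S0|/set0P/negP] := pselect (S !=set0); last first.
  rewrite negbK => /eqP S0; exists 1 => // u; rewrite mul1r.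
  have [->|u0] := eqVneq u 0; first by rewrite normr0 is_norm_ge0.
  suff : S (`|u|^-1 *: u) by rewrite S0.
  by rewrite /S /= normrZ normfV normr_id mulVf// normr_eq0.
have [c /set_mem Sc Nc] := compact_EVT_min S0 cS (continuous_subspaceT is_norm_continuous).
have Nc0 : 0 < N c.
  rewrite lt_neqAle is_norm_ge0 andbT eq_sym; apply/eqP => Nc0.
  have : c = 0 by case: HN => _ + _ _; exact.
  by move=> c0; move: Sc; rewrite /S /= c0 normr0 => /eqP; rewrite eq_sym oner_eq0.
exists (N c)^-1; first by rewrite invr_gt0.
move=> u; have [->|u0] := eqVneq u 0.
  by rewrite normr0 is_norm0 mulr0.
rewrite ler_pdivlMl// mulrC -ler_pdivlMl ?normr_gt0//.
have := Nc (`|u|^-1 *: u); rewrite is_normZ normfV normr_id; apply.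
by rewrite inE /S /= normrZ normfV normr_id mulVf// normr_eq0.
Qed.

(** The real [sup] is an upper bound only for a nonempty bounded set; boundedness comes from the
    equivalence of [N] with the max norm. *)
Lemma dual_norm_has_sup y : has_sup [set dotv y x | x in [set x | N x <= 1]].
Proof.
have [C C0 NC] := mx_norm_le.
split; first by exists (dotv y 0), 0 => //=; rewrite is_norm0.
exists (m%:R * (`|y| * C)) => _ [x /= Nx <-].
apply: (le_trans (ler_norm _)); apply: (le_trans (dotv_le _ _)).
rewrite ler_wpM2l// ler_wpM2l//; apply: (le_trans (NC _)).
by rewrite -[leRHS]mulr1 ler_pM2l.
Qed.

Lemma dual_norm_ge0 y : 0 <= dual_norm N y.
Proof.
apply: sup_upper_bound; first exact: dual_norm_has_sup.
by exists 0; rewrite ?dotv0r//= is_norm0.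
Qed.

Lemma dotv_dual y u : dotv y u <= dual_norm N y * N u.
Proof.
have [u0|u0] := eqVneq (N u) 0.
  have -> : u = 0 by case: HN => _ + _ _; exact.
  by rewrite dotv0r is_norm0 mulr0.
have Nu : 0 < N u by rewrite lt_neqAle eq_sym u0 is_norm_ge0.
rewrite -ler_pdivrMr// mulrC -dotvZr.
apply: sup_upper_bound; first exact: dual_norm_has_sup.
exists ((N u)^-1 *: u) => //=.
by rewrite is_normZ ger0_norm ?invr_ge0 ?is_norm_ge0// mulVf.
Qed.

Lemma dotv_dual_norm y u : `|dotv y u| <= dual_norm N y * N u.
Proof.
by rewrite ler_norml dotv_dual lerNl -dotvNr -[N u]is_normN dotv_dual.
Qed.

(** On the unit ball of [N], the splitting y = z + (y - z) compares the two suprema. The summand 1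
    keeps the constant positive when m = 0. *)
Lemma dual_norm_lipschitz : exists2 C, 0 < C &
  forall y z, `|dual_norm N y - dual_norm N z| <= C * `|y - z|.
Proof.
have [C C0 NC] := mx_norm_le.
have half y z : dual_norm N y <= dual_norm N z + (1 + m%:R * C) * `|y - z|.
  apply: ge_sup.
    by exists (dotv y 0), 0 => //=; rewrite is_norm0.
  move=> _ [x /= Nx <-].
  rewrite -{1}(subrK z y) dotvDl addrC lerD//.
    apply: (le_trans (dotv_dual _ _)).
    by rewrite -[leRHS]mulr1 ler_wpM2l ?dual_norm_ge0.
  apply: (le_trans (ler_norm _)); apply: (le_trans (dotv_le _ _)).
  rewrite mulrDl mul1r ler_wpDl// -mulrA ler_wpM2l// mulrC ler_wpM2r//.
  by apply: (le_trans (NC _)); rewrite -[leRHS]mulr1 ler_pM2l.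
exists (1 + m%:R * C); first by rewrite ltr_pwDl// mulr_ge0// ltW.
move=> y z; rewrite ler_norml lerBlDl half andbT lerBrDr -lerBrDl opprK.
by rewrite distrC half.
Qed.

End Norms.

(** * Bregman distances and prox mappings *)

(* [grad] is locked since comparing ['d w z] and ['d w z'] up to conversion unfolds
   the choice operator behind ['d], which does not terminate in practice. *)
Definition grad (R : realType) (m : nat) (w : 'rV[R]_m -> R) :
    'rV[R]_m -> 'rV[R]_m :=
  locked (fun z => \row_j 'd w z (delta_mx 0 j)).

Section Bregman.
Context {R : realType} {m : nat} (N : 'rV[R]_m -> R) (HN : is_norm N).
Context (A : set 'rV[R]_m) (cA : is_convex_set A) (w : 'rV[R]_m -> R).
Hypotheses (w1 : C1_on A w) (ws : strongly_convex_on A N 1 w).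
Implicit Types u v y z h : 'rV[R]_m.
Local Notation grad := (grad w).

Lemma diff_grad z h : 'd w z h = dotv (grad z) h.
Proof.
rewrite /grad -lock {1}(row_sum_delta h) linear_sum /=; apply: eq_bigr => j _.
by rewrite mxE linearZ /= mulrC.
Qed.

Lemma bregmanE z v : bregman w z v = w v - w z - (dotv (grad z) v - dotv (grad z) z).
Proof. by rewrite /bregman diff_grad dotvBr. Qed.

(** Differentiability along a ray with a positive real step, so that [grad_le] and [grad_ge] reduce
    to real arithmetic. *)
Lemma diff_directional z h e : A z -> 0 < e ->
  exists2 t, 0 < t & forall s, 0 < s < t ->
    `|w (z + s *: h) - w z - s * dotv (grad z) h| <= e * s.
Proof.
case: w1 => dw _ /dw {}dw e0.
have /cvg_ex[l wl] : derivable w z h by exact: diff_derivable.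
have : 'D_h w z = dotv (grad z) h by rewrite -diff_grad; exact: deriveE.
rewrite /derive (cvg_lim _ wl)// => lE.
move/cvgrPdist_le: wl => /(_ _ e0); rewrite near_withinE /= => /nbhs_ballP[t /= t0 wt].
exists t => // s /andP[s0 st].
have := wt s; rewrite -ball_normE /= sub0r normrN gtr0_norm// => /(_ st).
rewrite gt_eqF// => /(_ isT); rewrite lE [s *: h + z]addrC => {}wt.
have -> : w (z + s *: h) - w z - s * dotv (grad z) h =
          - (s * (dotv (grad z) h - s^-1 *: (w (z + s *: h) - w z))).
  by rewrite /GRing.scale /= mulrBr mulrA mulfV ?gt_eqF// mul1r opprB.
by rewrite normrN normrM gtr0_norm// mulrC ler_wpM2r// ltW.
Qed.

Lemma grad_le z h c K : A z ->
  (forall t, 0 < t <= 1 -> w (z + t *: h) - w z <= t * c + t ^+ 2 * K) ->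
  dotv (grad z) h <= c.
Proof.
move=> Az wc; apply/ler_addgt0Pr => e e0.
have e20 : 0 < e / 2 by rewrite divr_gt0.
have [t t0 wt] := diff_directional h Az e20.
(* The step lies in the range of the expansion, is at most 1 as the hypothesis requires, and makes
   the quadratic term at most s e / 2. *)
pose s := Num.min (t / 2) (Num.min 1 (e / 2 / (1 + `|K|))).
have K0 : 0 < 1 + `|K| by rewrite ltr_pwDl.
have s0 : 0 < s by rewrite !lt_min ltr01 !divr_gt0.
have st : s < t by rewrite gt_min ltr_pdivrMr// mulr_natr mulr2n ltrDl t0.
have s1 : s <= 1 by rewrite !ge_min lexx orbT.
have sK : s * (1 + `|K|) <= e / 2.
  by rewrite -ler_pdivlMr// !ge_min lexx !orbT.
have /wt := introT andP (conj s0 st).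
have /wc := introT andP (conj s0 s1).
move: (w _) (dotv _ _) => a b h1 /ler_normlP[h2 _].
suff : s * b <= s * (c + e) by rewrite ler_pM2l.
have : s * (s * K) <= s * (e / 2).
  rewrite ler_pM2l//; apply: le_trans sK.
  by rewrite ler_pM2l// (le_trans (ler_norm _))// lerDr.
by move: h1 h2; rewrite expr2; lra.
Qed.

Lemma grad_ge z h c : A z ->
  (forall t, 0 < t <= 1 -> t * c <= w (z + t *: h) - w z) -> c <= dotv (grad z) h.
Proof.
move=> Az wc; apply/ler_addgt0Pr => e e0.
have [t t0 wt] := diff_directional h Az e0.
pose s := Num.min (t / 2) 1.
have s0 : 0 < s by rewrite !lt_min ltr01 !divr_gt0.
have st : s < t by rewrite gt_min ltr_pdivrMr// mulr_natr mulr2n ltrDl t0.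
have s1 : s <= 1 by rewrite !ge_min lexx orbT.
have /wt := introT andP (conj s0 st).
have /wc := introT andP (conj s0 s1).
move: (w _) (dotv _ _) => a b h1 /ler_normlP[_ h2].
suff : s * c <= s * (b + e) by rewrite ler_pM2l.
by move: h1 h2; lra.
Qed.

Lemma convex_segment z v t : A z -> A v -> 0 < t <= 1 -> A (z + t *: (v - z)).
Proof.
move=> Az Av /andP[t0 t1]; have := @cA v z t Av Az; rewrite ltW// t1 => /(_ isT).
by rewrite scalerBr scalerBl scale1r addrCA.
Qed.

(** Strong convexity on the segment from z to v, divided by t as t tends to 0. Since t (1 - t) = t -
    t^2, the defect is the quadratic term allowed by [grad_le]. *)
Lemma bregman_ge z v : A z -> A v -> N (z - v) ^+ 2 / 2 <= bregman w z v.
Proof.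
move=> Az Av; rewrite bregmanE -dotvBr.
suff : dotv (grad z) (v - z) <= w v - w z - N (z - v) ^+ 2 / 2.
  move: (dotv _ _) (w _) (w _) (N _) => *; lra.
apply: (@grad_le _ _ _ (N (z - v) ^+ 2 / 2)) => // t t01.
have := @ws v z t Av Az.
have -> : t *: v + (1 - t) *: z = z + t *: (v - z).
  by rewrite scalerBr scalerBl scale1r addrCA.
case/andP: t01 => t0 t1; rewrite ltW// t1 => /(_ isT).
by rewrite (is_norm_distC HN v z); move: (w _) (w _) (w _) (N _) => *; lra.
Qed.

Lemma bregman_ge0 z v : A z -> A v -> 0 <= bregman w z v.
Proof.
by move=> Az Av; apply: le_trans (bregman_ge Az Av); rewrite divr_ge0// sqr_ge0.
Qed.

(** Sum of the lower bounds on V(z, v) and V(v, z), in which the values of w cancel. *)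
Lemma grad_monotone z v : A z -> A v ->
  N (z - v) ^+ 2 <= dotv (grad z) (z - v) - dotv (grad v) (z - v).
Proof.
move=> Az Av; have := bregman_ge Az Av; have := bregman_ge Av Az.
rewrite (is_norm_distC HN v z) !bregmanE !dotvBr.
move: (dotv (grad z) z) (dotv (grad z) v) (dotv (grad v) z) (dotv (grad v) v).
by move: (w z) (w v) (N _) => *; lra.
Qed.

Context (gam : R) (gam0 : 0 < gam).

Let prox_point y z u := is_argmin A (fun v => dotv y v + bregman w z v / gam) u.

(** First-order optimality: u is compared with the points u + t (v - u) of A, along which the linear
    part of the objective is exact in t. *)
Lemma prox_variational y z u v : A z -> A v -> prox_point y z u ->
  dotv (grad z) (v - u) - gam * dotv y (v - u) <= dotv (grad u) (v - u).
Proof.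
move=> Az Av [Au minu]; apply: grad_ge => // t t01.
have := minu _ (convex_segment Au Av t01).
rewrite !bregmanE !(dotvDr, dotvZr, dotvNr).
move: (w (u + _)) (w u) (w z) => a a' a'' h1.
move: (dotv (grad z) u) (dotv (grad z) v) (dotv (grad z) z) h1 => p q r h1.
move: (dotv y u) (dotv y v) h1 => b c /(ler_wpM2l (ltW gam0)).
rewrite [leLHS]mulrDr [leRHS]mulrDr ![gam * (_ / gam)]mulrC !divfK ?gt_eqF//; lra.
Qed.

(** The variational inequality amounts to V(u, v) <= V(z, v) - V(z, u) + gam <y, v - u>. Splitting v
    - u at z leaves gam <y, z - u>, which the dual norm and -V(z, u) control. *)
Lemma prox_descent y z u v : A z -> A v -> prox_point y z u ->
  bregman w u v <=
    bregman w z v + gam * dotv y (v - z) + gam ^+ 2 / 2 * dual_norm N y ^+ 2.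
Proof.
move=> Az Av pu; have := prox_variational Az Av pu.
case: pu => Au _; have := bregman_ge Az Au.
have := dotv_dual HN y (z - u).
rewrite !bregmanE !dotvBr.
move: (dotv (grad z) u) (dotv (grad z) v) (dotv (grad z) z) => p q r.
move: (dotv (grad u) u) (dotv (grad u) v) (dotv y z) (dotv y u) (dotv y v) => p' q' e f g.
move: (dual_norm N y) (N _) (w u) (w v) (w z) => D n a b c.
(* Young's inequality for gam D n; the resulting n^2 / 2 is absorbed by V(z, u). *)
move=> h1 h2 h3; have : 0 <= (gam * D - n) ^+ 2 by exact: sqr_ge0.
rewrite sqrrB exprMn; have := ler_wpM2l (ltW gam0) h1; lra.
Qed.

(** The variational inequality at v = z and the monotonicity of the gradient give N(z - u)^2 <= gam
    <y, z - u>. *)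
Lemma prox_move y z u : A z -> prox_point y z u ->
  N (z - u) <= gam * dual_norm N y.
Proof.
move=> Az pu; have := prox_variational Az Az pu.
case: pu => Au _; have := grad_monotone Az Au.
have := dotv_dual HN y (z - u) => h1 h2 h3.
have h4 : N (z - u) ^+ 2 <= gam * dual_norm N y * N (z - u).
  have := ler_wpM2l (ltW gam0) h1; move: h2 h3.
  move: (dotv (grad z) _) (dotv (grad u) _) (dotv y _) (N _) (dual_norm N y).
  move=> a b c n D; lra.
have [n0|n0] := eqVneq (N (z - u)) 0.
  by rewrite n0 mulr_ge0 ?dual_norm_ge0// ltW.
by move: h4; rewrite expr2 ler_pM2r// lt_neqAle eq_sym n0 is_norm_ge0.
Qed.

Lemma grad_within_continuous j z e : A z -> 0 < e -> exists2 del, 0 < del &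
  forall z', A z' -> `|z' - z| < del -> `|grad z' 0 j - grad z 0 j| < e.
Proof.
move=> Az e0; case: w1 => _ /(_ (delta_mx 0 j)).
have -> : (fun v => 'd w v (delta_mx 0 j) : R) = (fun v => grad v 0 j).
  by apply/funext => v; rewrite /grad -lock mxE.
move: grad => g /subspace_continuousP /(_ z Az) /cvgrPdist_lt /(_ e e0).
rewrite near_withinE /= => /nbhs_ballP[del /= del0 wd].
exists del => // z' Az' zz'.
by rewrite distrC; apply: wd => //; rewrite -ball_normE /= distrC.
Qed.

(** Each variational inequality is tested at the other prox point; adding the monotonicity of the
    gradient gives N(u1 - u2)^2 <= - <Z, u1 - u2>. Thus a prox point depends on y and z only through
    gam y - grad z, and continuously so. *)
Lemma prox_lipschitz : exists2 L, 0 < L & forall y1 z1 u1 y2 z2 u2,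
  A z1 -> A z2 -> prox_point y1 z1 u1 -> prox_point y2 z2 u2 ->
  `|u1 - u2| <= L * `|(gam *: y1 - grad z1) - (gam *: y2 - grad z2)|.
Proof.
have [C C0 NC] := mx_norm_le HN; have C1 := ltW C0.
exists (C * C * (1 + m%:R)); first by rewrite !mulr_gt0// ltr_pwDl.
move=> y1 z1 u1 y2 z2 u2 Az1 Az2 p1 p2.
have := prox_variational Az1 p2.1 p1; have := prox_variational Az2 p1.1 p2.
have := grad_monotone p1.1 p2.1.
set Z := (_ - grad z1) - _ => h1 h2 h3.
have h4 : N (u1 - u2) ^+ 2 <= - dotv Z (u1 - u2).
  rewrite /Z !(dotvBl, dotvZl) !dotvBr; move: h1 h2 h3; rewrite !dotvBr.
  move: (dotv (grad z1) u1) (dotv (grad z2) u1) (dotv (grad u1) u1) (dotv (grad u2) u1).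
  move: (dotv (grad z1) u2) (dotv (grad z2) u2) (dotv (grad u1) u2) (dotv (grad u2) u2).
  by move: (dotv y1 u1) (dotv y2 u1) (dotv y1 u2) (dotv y2 u2) (N _) => *; lra.
have h5 : - dotv Z (u1 - u2) <= m%:R * (`|Z| * `|u1 - u2|).
  by apply: le_trans (dotv_le _ _); rewrite -normrN ler_norm.
have h6 : `|u1 - u2| ^+ 2 <= C ^+ 2 * N (u1 - u2) ^+ 2.
  rewrite -exprMn; apply: lerXn2r; rewrite ?nnegrE//.
  by apply: mulr_ge0 => //; exact: is_norm_ge0.
have [->|n0] := eqVneq `|u1 - u2| 0.
  by rewrite !mulr_ge0.
have n1 : 0 < `|u1 - u2| by rewrite lt_neqAle eq_sym n0 /=.
rewrite -(ler_pM2r n1) -expr2; apply: (le_trans h6).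
have := ler_wpM2l (sqr_ge0 C) (le_trans h4 h5); move=> /le_trans; apply.
have -> : C * C * (1 + m%:R) * `|Z| * `|u1 - u2| =
    C ^+ 2 * ((1 + m%:R) * (`|Z| * `|u1 - u2|)) by rewrite expr2; ring.
by apply: ler_wpM2l; rewrite ?sqr_ge0//; apply: ler_wpM2r; rewrite ?mulr_ge0 ?lerDr.
Qed.

End Bregman.

(** * Measurability of continuous functions of random vectors *)

Section LocallyContinuous.
Context {d} {T : measurableType d} {R : realType} {m : nat}.
Implicit Types (D E : set T) (X : T -> 'rV[R]_m).

(* [E] is the union of the preimages of the rational boxes meeting [X @` D] inside
   [X @` E], of which there are countably many. *)
Lemma measurable_locally_saturated D E X : measurable D -> E `<=` D ->
  (forall j, measurable_fun D (fun t => X t 0 j)) ->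
  (forall t, E t -> exists2 del, 0 < del &
    forall s, D s -> `|X s - X t| < del -> E s) ->
  measurable E.
Proof.
move=> mD ED mX locE.
pose box (q : 'rV[rat]_m * nat) : set T := D `&` \bigcap_j
  (D `&` (fun t => X t 0 j) @^-1` `](ratr (q.1 0 j) - q.2.+1%:R^-1),
                                    (ratr (q.1 0 j) + q.2.+1%:R^-1)[%classic).
have mbox q : measurable (box q).
  apply: measurableI => //; apply: fin_bigcap_measurable; first exact: finite_finset.
  by move=> j _; apply: mX => //; exact: measurable_itv.
have boxP (q : 'rV[rat]_m * nat) s : D s -> (forall j, `|X s 0 j - ratr (q.1 0 j)| < q.2.+1%:R^-1) ->
    box q s.
  move=> Ds qs; split=> // j _; split=> //=.
  by rewrite in_itv/= -ltr_distl.
have boxE (q : 'rV[rat]_m * nat) s j : box q s -> `|X s 0 j - ratr (q.1 0 j)| < q.2.+1%:R^-1.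
  by move=> [_ /(_ j Logic.I)[_ /=]]; rewrite in_itv/= -ltr_distl.
pose F q := if pselect (box q `<=` E) then box q else set0.
rewrite (_ : E = \bigcup_q F q).
  apply: countable_bigcupT_measurable.
    exact: countableP.
  by move=> q; rewrite /F; case: pselect => _ /=; [exact: mbox|exact: measurable0].
apply/seteqP; split => [t Et|t [q _]]; last first.
  by rewrite /F; case: pselect => [bE /bE//|_ []].
have [del del0 delE] := locE _ Et.
have del20 : 0 < del / 2 by rewrite divr_gt0.
(* With a half-width below del / 2, any two points of a box are within del of each other, by way of
   its centre. *)
have [n _ /(_ n (leqnn n)) /= ndel] := near_infty_natSinv_lt (PosNum del20).
have /choice[q qP] : forall j, exists q : rat, `|X t 0 j - ratr q| < n.+1%:R^-1.
  move=> j; have : X t 0 j - n.+1%:R^-1 < X t 0 j + n.+1%:R^-1.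
    by rewrite ltrD2l gtrN// invr_gt0.
  by move=> /rat_in_itvoo[q]; rewrite in_itv/= -ltr_distl distrC; exists q.
exists (\row_j q j, n) => //.
have tbox : box (\row_j q j, n) t.
  by apply: boxP => [|j]; [exact: ED|rewrite mxE].
rewrite /F; case: pselect => // -[] s /[dup] -[Ds _] sbox.
apply: delE => //; apply: mx_norm_lt => // j; rewrite !mxE.
rewrite -(subrKA (ratr (q j))); apply: le_lt_trans (ler_normD _ _) _.
rewrite (splitr del) ltrD//; apply: lt_trans ndel.
  by have := boxE _ _ j sbox; rewrite /= mxE.
by rewrite distrC.
Qed.

(** The set where h > a is locally saturated, with the radius that continuity gives for e = h t - a.
    Continuity is asked only along the values of X on D, because gradients are continuous only
    within the sets X_i. *)
Lemma measurable_fun_locally_continuous D X (h : T -> R) : measurable D ->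
  (forall j, measurable_fun D (fun t => X t 0 j)) ->
  (forall t e, D t -> 0 < e -> exists2 del, 0 < del &
    forall s, D s -> `|X s - X t| < del -> `|h s - h t| < e) ->
  measurable_fun D h.
Proof.
move=> mD mX hc; apply: (measurability _ (RGenOInfty.measurableE R)).
move=> _ [_ [a ->] <-].
apply: (@measurable_locally_saturated D _ X) => // t [Dt].
rewrite /= in_itv/= andbT => at0.
have [del del0 delh] := hc t (h t - a) Dt ltac:(by rewrite subr_gt0).
exists del => // s Ds st; split=> //=; rewrite in_itv/= andbT.
by have := delh s Ds st; rewrite ltr_norml opprB => /andP[+ _]; rewrite ltrBrDr subrK.
Qed.

Lemma measurable_preimage_closed X (B : set 'rV[R]_m) :
  (forall j, measurable_fun [set: T] (fun t => X t 0 j)) -> closed B ->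
  measurable (X @^-1` B).
Proof.
move=> mX cB; rewrite -[X @^-1` B]setCK; apply: measurableC.
apply: (@measurable_locally_saturated setT _ X) => // t Bt.
have : open (~` B) by rewrite openC.
move=> /(_ (X t) Bt) /nbhs_ballP[del /= del0 delB].
exists del => // s _ st Bs; apply: (delB (X s)) => //.
by rewrite -ball_normE /= distrC.
Qed.

End LocallyContinuous.

(** * Integration against an independent variable *)

Section IntegralComplements.
Local Open Scope ereal_scope.
Context {d1 : measure_display} {T1 : measurableType d1} {R : realType}.

(** The restricted measure has no mass outside [D], and both measures agree on subsets of [D]. *)
Lemma ge0_integral_mrestr (mu : {measure set T1 -> \bar R}) (D : set T1)
    (mD : measurable D) (f : T1 -> \bar R) : measurable_fun setT f ->
  (forall t, 0 <= f t) ->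
  \int[mrestr mu mD]_t f t = \int[mu]_(t in D) f t.
Proof.
move=> mf f0.
rewrite (@ge0_negligible_integral _ _ _ _ setT (~` D))//=; last 2 first.
  exact: measurableC.
  by rewrite /mrestr setICl measure0.
rewrite setTD setCK; apply: eq_measure_integral => A mA AD.
by rewrite /= /mrestr setIidl.
Qed.

(* No measurability is needed: the integral is a difference of suprema over the
   simple functions below the positive and negative parts. *)
Lemma le_integral_pointwise (mu : {measure set T1 -> \bar R}) (f g : T1 -> \bar R) :
  (forall t, f t <= g t) -> \int[mu]_t f t <= \int[mu]_t g t.
Proof.
move=> fg; rewrite /integral !patch_setT.
apply: leeB; apply: le_ereal_sup => _ [h /= hf <-]; exists h => //= t.
  by apply: le_trans (hf t) _; rewrite !funeposE ge_max !le_max fg lexx orbT.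
by apply: le_trans (hf t) _; rewrite !funenegE ge_max !le_max leeN2 fg lexx orbT.
Qed.

Lemma integral_le_cst (P : probability T1 R) (f : T1 -> \bar R) c :
  (forall t, f t <= c%:E) -> \int[P]_t f t <= c%:E.
Proof.
move=> fc; apply: le_trans (le_integral_pointwise P fc) _.
by rewrite -[leRHS]mule1 -(probability_setT P) -integral_cst.
Qed.

End IntegralComplements.

Section IntegralIndep.
Local Open Scope ereal_scope.
Context {d0 d1 d2 : measure_display} {T0 : measurableType d0}.
Context {T1 : measurableType d1} {T2 : measurableType d2} {R : realType}.
Context (P : probability T0 R) (mu : probability T2 R).
Context (X : T0 -> T1) (Y : T0 -> T2) (mX : measurable_fun setT X)
  (mY : measurable_fun setT Y) (D : set T0) (mD : measurable D).
Context (c : R) (c0 : (0 <= c)%R).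
Hypothesis indep : forall A B, measurable A -> measurable B ->
  c%:E * P (D `&` (X @^-1` A `&` Y @^-1` B)) = P (X @^-1` A) * mu B.

Let XY t := (X t, Y t).

Let mXY : measurable_fun setT XY.
Proof. by apply/measurable_fun_pairP. Qed.

Let X_mixin := isMeasurableFun.Build _ _ _ _ X mX.
Let Xf : {mfun T0 >-> T1} := HB.pack X X_mixin.
Let XY_mixin := isMeasurableFun.Build _ _ _ _ XY mXY.
Let XYf : {mfun T0 >-> (T1 * T2)%type} := HB.pack XY XY_mixin.

Let PX : probability T1 R := distribution P Xf.

(** By uniqueness of the product measure, the image under (X, Y) of c times P restricted to D is
    [PX \x mu]. In the application D is the event i_(k+1) = i and c = b, which compensates the
    probability 1/b of D. *)
Let ge0_integral_law (f : T1 * T2 -> \bar R) :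
  measurable_fun setT f -> (forall z, 0 <= f z) ->
  c%:E * \int[P]_(t in D) f (X t, Y t) = \int[PX \x mu]_z f z.
Proof.
move=> mf f0; apply/esym.
rewrite (eq_measure_integral (mscale (NngNum c0) (pushforward (mrestr P mD) XYf))); last first.
  move=> A mA _; apply: product_measure_unique => // {mA A} A B mA mB.
  rewrite /mscale /= /pushforward /mrestr /= /PX /distribution /pushforward /=.
  by rewrite -indep// [in RHS]setIC.
rewrite ge0_integral_mscale//= ge0_integral_pushforward//=.
rewrite ge0_integral_mrestr//; exact: measurableT_comp.
Qed.

Let ge0_integral_PX (f : T1 -> \bar R) :
  measurable_fun setT f -> (forall z, 0 <= f z) ->
  \int[PX]_t f t = \int[P]_t f (X t).
Proof. by move=> mf f0; rewrite /PX /distribution ge0_integral_pushforward. Qed.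

Lemma ge0_integral_indep (f : T1 * T2 -> \bar R) :
  measurable_fun setT f -> (forall z, 0 <= f z) ->
  c%:E * \int[P]_(t in D) f (X t, Y t) = \int[P]_t \int[mu]_s f (X t, s).
Proof.
move=> mf f0; rewrite ge0_integral_law// fubini_tonelli1// ge0_integral_PX//.
  exact: measurable_fun_fubini_tonelli_F.
by move=> y; exact: integral_ge0.
Qed.

Hypothesis cpos : (0 < c)%R.

(** Finiteness passes back from the iterated integral because c > 0: c times +oo would be +oo. *)
Lemma integrable_indep (f : T1 * T2 -> \bar R) :
  measurable_fun setT f ->
  \int[P]_t \int[mu]_s `|f (X t, s)| < +oo ->
  P.-integrable D (fun t => f (X t, Y t)).
Proof.
move=> mf foo; apply/integrableP; split.
  by apply: measurable_funTS; exact: measurableT_comp.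
have := @ge0_integral_indep (abse \o f).
rewrite /= => /(_ _ _)/esym E; rewrite E in foo; last 2 first.
  exact: measurableT_comp.
  by move=> z; exact: abse_ge0.
by rewrite ltey; apply: contraTneq foo => ->; rewrite gt0_muley// lte_fin.
Qed.

Lemma integral_indep (f : T1 * T2 -> \bar R) :
  measurable_fun setT f ->
  \int[P]_t \int[mu]_s `|f (X t, s)| < +oo ->
  c%:E * \int[P]_(t in D) f (X t, Y t) = \int[P]_t \int[mu]_s f (X t, s) /\
  P.-integrable setT (fun t => \int[mu]_s f (X t, s)).
Proof.
move=> mf foo; have intf : (PX \x mu).-integrable setT f.
  apply/integrable12ltyP => //; rewrite ge0_integral_PX//.
    by apply: (measurable_fun_fubini_tonelli_F (abse \o f)) => //=; exact: measurableT_comp.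
  by move=> z; exact: integral_ge0.
have intF := integrable_fubini_F intf.
have intFX : P.-integrable setT (fun t => \int[mu]_s f (X t, s)).
  apply/integrableP; split.
    by apply: (measurableT_comp (measurable_fubini_F intf)).
  have /integrableP[mF] := intF; rewrite ge0_integral_PX//.
  exact: measurableT_comp.
split=> //; transitivity (\int[PX]_t fubini_F mu f t); last first.
  rewrite /PX /distribution integral_pushforward//.
  exact: (measurable_fubini_F intf).
have intfD := integrable_indep mf foo.
(* The nonnegative case applies to the positive and negative parts; multiplication by c distributes
   over their difference since the positive part has finite integral. *)
rewrite integral12_prod_meas1// [RHS]integralE -!ge0_integral_law//;
  [|exact: measurable_funeneg|exact: measurable_funepos].
rewrite integralE muleBr//; last first.
  by apply: fin_num_adde_defr; exact: integrable_pos_fin_num intfD.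
by congr (_ * _ - _ * _); apply: eq_integral => t _; rewrite ?funeposE ?funenegE.
Qed.

End IntegralIndep.

(** * The sigma-algebras of the history *)

Section History.
Local Open Scope ereal_scope.
Context {R : realType} {b : nat} {d dX : measure_display}.
Context {Omega : measurableType d} {Xi : measurableType dX}.
Context (P : probability Omega R) (muxi : probability Xi R).
Context (ik : nat -> Omega -> 'I_b) (xi : nat -> Omega -> Xi).
Hypothesis Hikm : forall k (A : set 'I_b), measurable (ik k @^-1` A).
Hypothesis Hxim : forall k, measurable_fun setT (xi k).
Hypothesis Hunif : forall k i, (1 <= k)%N -> P (ik k @^-1` [set i]) = (b%:R^-1)%:E.
Hypothesis Hlaw : forall k B, (1 <= k)%N -> measurable B ->
  P (xi k @^-1` B) = muxi B.
Hypothesis Hind : indep_family P ik xi.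

(** Cylinder events on the draws of steps 1 to k, steps being numbered from 1. Their probabilities
    are those that [indep_family] factorises. *)
Definition rectangle (k : nat) (a : nat -> set 'I_b) (B : nat -> set Xi) : set Omega :=
  \bigcap_(j in [set` iota 1 k]) (ik j @^-1` a j `&` xi j @^-1` B j).

Definition rectangles (k : nat) : set (set Omega) :=
  [set A | exists a B, (forall j, measurable (B j)) /\ A = rectangle k a B].

(** [Omega] with the sigma-algebra generated by (i_1, xi_1), ..., (i_k, xi_k). *)
Definition history (k : nat) := g_sigma_algebraType (rectangles k).

Lemma mem_steps n j : [set` iota 1 n] j <-> (0 < j <= n)%N.
Proof. by rewrite [X in X <-> _]/mkset mem_iota add1n ltnS. Qed.

Lemma measurable_xi_preimage j B : measurable B -> measurable (xi j @^-1` B).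
Proof. by move=> mB; rewrite -[_ @^-1` _]setTI; exact: Hxim. Qed.

Lemma rectangles_measurable k : rectangles k `<=` measurable.
Proof.
move=> _ [a [B [mB ->]]]; apply: fin_bigcap_measurable; first exact: finite_seq.
by move=> j _; apply: measurableI => //; exact: measurable_xi_preimage.
Qed.

Lemma history_sub k : <<s rectangles k >> `<=` (measurable : set (set Omega)).
Proof.
apply: smallest_sub; last exact: rectangles_measurable.
exact: sigma_algebra_measurable.
Qed.

Lemma rectangles_setI k : setI_closed (rectangles k).
Proof.
move=> _ _ [a [B [mB ->]]] [a' [B' [mB' ->]]].
exists (fun j => a j `&` a' j), (fun j => B j `&` B' j); split.
  by move=> j; exact: measurableI.
rewrite /rectangle -bigcapI; apply: eq_bigcapr => j _.
by rewrite !preimage_setI setIACA.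
Qed.

Lemma rectangles_setT k : rectangles k setT.
Proof.
exists (fun=> setT), (fun=> setT); split=> //.
by apply/seteqP; split=> // om _ j _.
Qed.

Lemma rectanglesS k : rectangles k `<=` rectangles k.+1.
Proof.
move=> _ [a [B [mB ->]]].
exists (fun j => if j == k.+1 then setT else a j),
  (fun j => if j == k.+1 then setT else B j); split.
  by move=> j; case: ifP.
apply/seteqP; split=> om Hom j /mem_steps jin.
  by case: eqP => [->//|jk]; apply: Hom; apply/mem_steps; lia.
have /Hom : [set` iota 1 k.+1] j by apply/mem_steps; lia.
by case: eqP => [jk|//]; lia.
Qed.

Lemma measurable_history_id k :
  measurable_fun [set: Omega] (id : Omega -> history k).
Proof. by move=> _ A mA; rewrite setTI; exact: (@history_sub k A mA). Qed.

Lemma measurable_historyS k :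
  measurable_fun [set: history k.+1] (id : history k.+1 -> history k).
Proof.
move=> _ A mA; rewrite setTI; move: A mA.
apply: smallest_sub; first exact: smallest_sigma_algebra.
by move=> A /rectanglesS; exact: sub_sigma_algebra.
Qed.

Lemma rectangle_last k (a : set 'I_b) (B : set Xi) : measurable B ->
  rectangles k.+1 (ik k.+1 @^-1` a `&` xi k.+1 @^-1` B).
Proof.
move=> mB; exists (fun j => if j == k.+1 then a else setT),
  (fun j => if j == k.+1 then B else setT); split.
  by move=> j; case: ifP.
apply/seteqP; split=> om => [Hom j _|/(_ k.+1)]; first by case: eqP => [->|].
by rewrite eqxx; apply; apply/mem_steps; lia.
Qed.

Lemma measurable_history_xi k : measurable_fun [set: history k.+1] (xi k.+1).
Proof.
move=> _ B mB; rewrite setTI; apply: sub_sigma_algebra.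
by have := @rectangle_last k setT B mB; rewrite preimage_setT setTI.
Qed.

Lemma measurable_history_ik k (a : set 'I_b) :
  measurable (ik k.+1 @^-1` a : set (history k.+1)).
Proof.
apply: sub_sigma_algebra.
by have := @rectangle_last k a setT measurableT; rewrite preimage_setT setIT.
Qed.

Hypothesis b0 : (0 < b)%N.

(** As functions of A, both sides are finite measures. They agree on the rectangles, a pi-system
    containing the whole space, where b cancels the probability 1/b of the index. *)
Lemma history_indep k i (A : set Omega) (B : set Xi) :
  <<s rectangles k >> A -> measurable B ->
  b%:R%:E * P (ik k.+1 @^-1` [set i] `&` (A `&` xi k.+1 @^-1` B)) = P A * muxi B.
Proof.
move=> sA mB.
have mD : measurable (ik k.+1 @^-1` [set i] `&` xi k.+1 @^-1` B).
  by apply: measurableI => //; exact: measurable_xi_preimage.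
have bge0 : (0 <= b%:R :> R)%R by [].
have muB0 : (0 <= fine (muxi B))%R by exact: fine_ge0.
pose m1 : {measure set Omega -> \bar R} := mscale (NngNum bge0) (mrestr P mD).
pose m2 : {measure set Omega -> \bar R} := mscale (NngNum muB0) P.
suff : m1 A = m2 A.
  rewrite /m1 /m2 /= /mscale /= /mrestr fineK ?fin_num_measure// [RHS]muleC => <-.
  by rewrite setICA.
apply: (@g_sigma_algebra_measure_unique _ R Omega (rectangles k) _ (fun=> setT)) => //.
- exact: rectangles_measurable.
- by move=> _; exact: rectangles_setT.
- by rewrite bigcup_const//; exists 0%N.
- exact: rectangles_setI.
- move=> _ [a [C [mC ->]]].
  rewrite /m1 /m2 /= /mscale /= /mrestr fineK ?fin_num_measure//.
  (* The constraints on step k+1 are appended to the rectangle, so that [Hind] applies to steps 1 to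
     k+1. *)
  pose a' j := if j == k.+1 then [set i] else a j.
  pose C' j := if j == k.+1 then B else C j.
  have mC' j : measurable (C' j) by rewrite /C'; case: ifP.
  have pos n : all (fun j => 0 < j)%N (iota 1 n).
    by apply/allP => j; rewrite mem_iota => /andP[].
  have -> : rectangle k a C `&` (ik k.+1 @^-1` [set i] `&` xi k.+1 @^-1` B) =
      rectangle k.+1 a' C'.
    apply/seteqP; split=> om.
      move=> [Hom [i1 i2]] j /mem_steps jin; rewrite /a' /C'.
      by case: eqP => [->//|jk]; apply: Hom; apply/mem_steps; lia.
    move=> Hom; split; last first.
      have /Hom : [set` iota 1 k.+1] k.+1 by apply/mem_steps; lia.
      by rewrite /a' /C' eqxx.
    move=> j /mem_steps jin.
    have /Hom : [set` iota 1 k.+1] j by apply/mem_steps; lia.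
    by rewrite /a' /C'; case: eqP => [jk|//]; lia.
  have iotaS : iota 1 k.+1 = iota 1 k ++ [:: k.+1].
    by have := iotaD 1 k 1; rewrite addn1 add1n.
  rewrite /rectangle !Hind ?iota_uniq// iotaS big_cat big_seq1.
  rewrite /a' /C' eqxx Hunif// Hlaw//.
  set p := \prod_(j <- _) _; set q := \prod_(j <- _) _.
  have -> : p = q.
    rewrite /p /q big_seq [RHS]big_seq; apply: eq_bigr => j; rewrite mem_iota => jin.
    by case: eqP => // jk; lia.
  rewrite muleCA [X in _ = X]muleC; congr (_ * _).
  by rewrite muleA -EFinM mulfV ?mul1e// pnatr_eq0 -lt0n.
- move=> _; rewrite /m1 /= /mscale /= /mrestr.
  by rewrite lte_mul_pinfty// ?lee_fin// -ge0_fin_numE// fin_num_measure//; exact: measurableI.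
Qed.

End History.

(** * Block decomposition *)

Section Blocks.
Context {R : realType} {b : nat} {nb : 'I_b -> nat}.
Implicit Types x y : 'rV[R]_(\sum_(i < b) nb i).

Lemma blkE x i l : blk x i 0 l = x 0 (tagnat.Rank i l).
Proof. by rewrite mxE. Qed.

Lemma coord_blk x s : x 0 s = blk x (tagnat.sig1 s) 0 (tagnat.sig2 s).
Proof. by rewrite -[in LHS](submxrowK x) mxE. Qed.

Lemma blkB x y i : blk (x - y) i = blk x i - blk y i.
Proof. exact: submxrowB. Qed.

Lemma blkD x y i : blk (x + y) i = blk x i + blk y i.
Proof. exact: submxrowD. Qed.

Lemma blkZ a x i : blk (a *: x) i = a *: blk x i.
Proof. by apply/rowP => l; rewrite !mxE. Qed.

Lemma dotv_blk x y : dotv x y = \sum_i dotv (blk x i) (blk y i).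
Proof.
have dotvE m (u v : 'rV[R]_m) : dotv u v = (u *m v^T) 0 0.
  by rewrite mxE; apply: eq_bigr => j _; rewrite mxE.
rewrite dotvE -[in LHS](submxrowK x) -[in LHS](submxrowK y) tr_mxrow mul_mxrow_mxcol.
by rewrite summxE; apply: eq_bigr => i _; rewrite dotvE.
Qed.

End Blocks.

(** * Bounds in mean *)

Section MeanLe.
Context {d : measure_display} {T : measurableType d} {R : realType} (P : probability T R).
Implicit Types (h : T -> R) (c : R).

(** Integrability is part of the bound, so that bounds add up without sign conditions. *)
Definition mean_le h c : Prop :=
  P.-integrable setT (EFin \o h) /\ (\int[P]_t (h t)%:E <= c%:E)%E.

Lemma mean_leD h1 h2 c1 c2 : mean_le h1 c1 -> mean_le h2 c2 ->
  mean_le (fun t => h1 t + h2 t) (c1 + c2).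
Proof.
move=> [i1 m1] [i2 m2]; split.
  rewrite (_ : EFin \o _ = (EFin \o h1) \+ (EFin \o h2))%E//.
  exact: integrableD.
under eq_integral do rewrite EFinD.
by rewrite integralD// EFinD; apply: leeD.
Qed.

Lemma mean_leZ a h c : 0 <= a -> mean_le h c -> mean_le (fun t => a * h t) (a * c).
Proof.
move=> a0 [ih mh]; split.
  rewrite (_ : EFin \o _ = fun t => (a%:E * (EFin \o h) t)%E)//.
  exact: integrableZl.
under eq_integral do rewrite EFinM.
by rewrite integralZl// EFinM lee_wpmul2l.
Qed.

Lemma mean_le_cst c : mean_le (fun=> c) c.
Proof.
split; first exact: finite_measure_integrable_cst.
exact: integral_le_cst.
Qed.

Lemma mean_le_sum (I : Type) (s : seq I) (h : I -> T -> R) (c : I -> R) :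
  (forall i, mean_le (h i) (c i)) ->
  mean_le (fun t => \sum_(i <- s) h i t) (\sum_(i <- s) c i).
Proof.
move=> mh; elim: s => [|i s IH].
  rewrite big_nil (_ : (fun _ => _) = fun=> 0); first exact: mean_le_cst.
  by apply/funext => t; rewrite big_nil.
rewrite big_cons (_ : (fun _ => _) = fun t => h i t + \sum_(j <- s) h j t).
  exact: mean_leD.
by apply/funext => t; rewrite big_cons.
Qed.

End MeanLe.

(** Jensen's inequality, by induction on the number of points. Only the first weight has to be
    positive: later weights are 0 once [Gamma] vanishes. *)
Lemma convex_on_sum (R : realType) (m : nat) (A : set 'rV[R]_m) (h : 'rV[R]_m -> R)
    (t : nat -> R) (u : nat -> 'rV[R]_m) (n : nat) :
  is_convex_set A -> convex_on A h -> (forall k, A (u k)) ->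
  0 < t 0%N -> (forall k, 0 <= t k) ->
  let S := \sum_(k < n.+1) t k in
  A (S^-1 *: \sum_(k < n.+1) t k *: u k) /\
  h (S^-1 *: \sum_(k < n.+1) t k *: u k) <= S^-1 * \sum_(k < n.+1) t k * h (u k).
Proof.
move=> cA ch Au t0 tge; elim: n => [|n].
  by rewrite /= !big_ord1 scalerA mulVf ?gt_eqF// scale1r mulrA mulVf ?gt_eqF// mul1r.
have Spos k : 0 < \sum_(j < k.+1) t j.
  by rewrite big_ord_recl ltr_pwDl// sumr_ge0.
rewrite /= !(big_ord_recr n.+1) /=; have := Spos n.+1; rewrite big_ord_recr /=.
have := Spos n; set S := \sum_(_ < _) _; set s := t n.+1.
set U := \sum_(_ < _) _; set H := \sum_(_ < _) _; set v := u n.+1.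
(* The new average combines the old one and [v] with weights [a] and [1 - a]. *)
move=> S0 Ss0 [AU hU]; pose a := S / (S + s).
have a01 : 0 <= a <= 1.
  apply/andP; split; first by apply: divr_ge0; exact: ltW.
  by rewrite ler_pdivrMr// mul1r lerDl tge.
have aE : a * S^-1 = (S + s)^-1 by rewrite /a mulrAC mulfV ?mul1r// gt_eqF.
have a1E : 1 - a = (S + s)^-1 * s.
  by rewrite /a; apply: (mulIf (lt0r_neq0 Ss0)); rewrite mulrBl mul1r divfK ?gt_eqF//
    mulrAC mulVf ?gt_eqF// mul1r addrAC subrr add0r.
have -> : (S + s)^-1 *: (U + s *: v) = a *: (S^-1 *: U) + (1 - a) *: v.
  by rewrite scalerDr !scalerA aE a1E.
split; first exact: (cA _ _ _ AU (Au _) a01).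
apply: le_trans (ch _ _ _ AU (Au _) a01) _.
have -> : (S + s)^-1 * (H + s * h v) = a * (S^-1 * H) + (1 - a) * h v.
  by rewrite a1E mulrA aE mulrDr mulrA.
by rewrite lerD2r; apply: ler_wpM2l => //; case/andP: a01.
Qed.

(** * The stochastic block mirror descent method *)

Section SBMD.
Context {R : realType} {b : nat} (b0 : (0 < b)%N) {nb : 'I_b -> nat}.
Local Notation n := (\sum_(i < b) nb i)%N.
Context (Ns : forall i : 'I_b, 'rV[R]_(nb i) -> R) (HNs : forall i, is_norm (@Ns i)).
Arguments Ns : clear implicits.
Context (Xs : forall i : 'I_b, set 'rV[R]_(nb i)).
Arguments Xs : clear implicits.
Hypothesis cXs : forall i, closed (Xs i).
Hypothesis vXs : forall i, is_convex_set (Xs i).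
Context (ws : forall i : 'I_b, 'rV[R]_(nb i) -> R).
Arguments ws : clear implicits.
Hypothesis w1 : forall i, C1_on (Xs i) (ws i).
Hypothesis wsc : forall i, strongly_convex_on (Xs i) (Ns i) 1 (ws i).
Context {dX : measure_display} {Xi : measurableType dX} (muxi : probability Xi R).
Context (G : 'rV[R]_n -> Xi -> 'rV[R]_n) (g : 'rV[R]_n -> 'rV[R]_n).
Hypothesis HGmeas : forall j, measurable_fun
  [set p : n.-tuple R * Xi | in_prod Xs (row_of_tuple p.1)]
  (fun p => G (row_of_tuple p.1) p.2 0 j).
Hypothesis HGunb : forall x, in_prod Xs x -> forall j,
  muxi.-integrable setT (fun s => (G x s 0 j)%:E) /\
  (\int[muxi]_s (G x s 0 j)%:E)%E = (g x 0 j)%:E.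
Context (M : 'I_b -> R).
Hypothesis HM : forall x, in_prod Xs x -> forall i,
  (\int[muxi]_s ((dual_norm (Ns i) (blk (G x s) i)) ^+ 2)%:E <= (M i ^+ 2)%:E)%E.

(** * Measurability of blocks and of the feasibility condition *)

Section Measurability.
Context {d : measure_display} {T : measurableType d} (X : T -> 'rV[R]_n).
Hypothesis mX : forall j, measurable_fun setT (fun t => X t 0 j).

Lemma measurable_blk i l : measurable_fun setT (fun t => blk (X t) i 0 l).
Proof. by under eq_fun do rewrite blkE; exact: mX. Qed.

Lemma measurable_norm_blk i (c : 'rV[R]_n) :
  measurable_fun setT (fun t => Ns i (blk (c - X t) i)).
Proof.
apply: (@measurable_fun_locally_continuous _ _ _ _ _ (fun t => blk (X t) i)) => //.
  exact: measurable_blk.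
have [C C0 NC] := is_norm_le_mx (HNs i).
move=> t e _ e0; exists (C^-1 * e); first by rewrite mulr_gt0// invr_gt0.
move=> s _ st; apply: (le_lt_trans (is_norm_dist (HNs i) _ _)).
apply: (le_lt_trans (NC _)); rewrite -ltr_pdivlMl//.
have -> : blk (c - X s) i - blk (c - X t) i = blk (X t) i - blk (X s) i.
  by rewrite !blkB opprB addrC subrKA.
by rewrite distrC.
Qed.

End Measurability.

Lemma measurable_in_prod {d} {T : measurableType d} (X : T -> 'rV[R]_n) :
  (forall j, measurable_fun setT (fun t => X t 0 j)) ->
  measurable [set t | in_prod Xs (X t)].
Proof.
move=> mX.
have -> : [set t | in_prod Xs (X t)] =
    \bigcap_(i in [set: 'I_b]) (fun t => blk (X t) i) @^-1` Xs i.
  by apply/seteqP; split => t Xt i => [_|]; [exact: Xt|exact: (Xt i Logic.I)].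
apply: fin_bigcap_measurable; first exact: finite_finset.
by move=> i _; apply: measurable_preimage_closed => //; exact: measurable_blk.
Qed.

(** * Oracle values and prox points at a random feasible point *)

Section Oracle.
Context {d : measure_display} {T : measurableType d}.
Context (X : T -> 'rV[R]_n) (Y : T -> Xi).
Hypothesis mX : forall j, measurable_fun setT (fun t => X t 0 j).
Hypothesis mY : measurable_fun setT Y.
Hypothesis inX : forall t, in_prod Xs (X t).

Lemma measurable_oracle j : measurable_fun setT (fun t => G (X t) (Y t) 0 j).
Proof.
(* [HGmeas] speaks of tuples, which carry the product sigma-algebra; the random point is passed
   through them. *)
pose h t : n.-tuple R * Xi := ([tuple X t 0 j | j < n], Y t).
have hK t : row_of_tuple (h t).1 = X t.
  by apply/rowP => k; rewrite mxE tnth_mktuple.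
have -> : (fun t => G (X t) (Y t) 0 j) =
    (fun p => G (row_of_tuple p.1) p.2 0 j) \o h.
  by apply/funext => t /=; rewrite hK.
apply: (measurable_comp _ _ (HGmeas j)).
- apply: (@measurable_in_prod _ _ (fun p : n.-tuple R * Xi => row_of_tuple p.1)) => k.
  rewrite (_ : (fun _ => _) = (fun t : n.-tuple R => tnth t k) \o fst); last first.
    by apply/funext => t; rewrite /= mxE.
  by apply: measurableT_comp => //; exact: measurable_tnth.
- by move=> _ [t _ <-] /=; rewrite hK.
- apply/measurable_fun_pairP; split => //.
  apply/measurable_fun_tnthP => k.
  rewrite (_ : _ \o _ = fun t => X t 0 k); first exact: mX.
  by apply/funext => t; rewrite /= tnth_mktuple.
Qed.

Lemma measurable_dual_oracle i :
  measurable_fun setT (fun t => dual_norm (Ns i) (blk (G (X t) (Y t)) i)).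
Proof.
apply: (@measurable_fun_locally_continuous _ _ _ _ _
  (fun t => blk (G (X t) (Y t)) i)) => //.
  by move=> l; under eq_fun do rewrite blkE; exact: measurable_oracle.
have [C C0 NC] := dual_norm_lipschitz (HNs i).
move=> t e _ e0; exists (C^-1 * e); first by rewrite mulr_gt0// invr_gt0.
by move=> s _ st; apply: (le_lt_trans (NC _ _)); rewrite -ltr_pdivlMl.
Qed.

Lemma measurable_dotv_oracle i (c : 'rV[R]_n) :
  measurable_fun setT (fun t => dotv (blk (G (X t) (Y t)) i) (blk (c - X t) i)).
Proof.
apply: measurable_sum => l; apply: measurable_funM.
  by under eq_fun do rewrite blkE; exact: measurable_oracle.
under eq_fun do rewrite blkE !mxE.
by apply: measurable_funB => //; exact: mX.
Qed.

Context (gam : R) (gam0 : 0 < gam) (i : 'I_b) (D : set T) (mD : measurable D).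
Context (U : T -> 'rV[R]_(nb i)).
Hypothesis HU : forall t, D t -> is_argmin (Xs i)
  (fun u => dotv (blk (G (X t) (Y t)) i) u + bregman (ws i) (blk (X t) i) u / gam) (U t).

(* The prox point is a Lipschitz function of [gam G_i - grad w_i (X_i)]. *)
Lemma measurable_prox l : measurable_fun D (fun t => U t 0 l).
Proof.
pose Z t := gam *: blk (G (X t) (Y t)) i - grad (ws i) (blk (X t) i).
have mZ k : measurable_fun setT (fun t => Z t 0 k).
  rewrite /Z; under eq_fun do rewrite mxE [X in X + _]mxE blkE [X in _ + X]mxE.
  apply: measurable_funB.
    by apply: measurable_funM => //; exact: measurable_oracle.
  apply: (@measurable_fun_locally_continuous _ _ _ _ _ (fun t => blk (X t) i)) => //.
    exact: measurable_blk.
  move=> t e _ e0.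
  have [del del0 gd] := grad_within_continuous (w1 i) k (inX t i) e0.
  by exists del => // s _; apply: gd; exact: inX.
apply: (@measurable_fun_locally_continuous _ _ _ _ _ Z) => //.
  by move=> k; exact: measurable_funTS.
have [L L0 UL] := prox_lipschitz (HNs i) (@vXs i) (w1 i) (@wsc i) gam0.
move=> t e Dt e0; exists (L^-1 * e); first by rewrite mulr_gt0// invr_gt0.
move=> s Ds st.
have -> : U s 0 l - U t 0 l = (U s - U t) 0 l by rewrite !mxE.
apply: (le_lt_trans (mx_norm_coord _ _)).
apply: (le_lt_trans (UL _ _ _ _ _ _ (inX s i) (inX t i) (HU Ds) (HU Dt))).
by rewrite -ltr_pdivlMl.
Qed.

End Oracle.

(** The second moment bound [HM] controls the first moment, since D <= 1 + D^2. *)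
Lemma oracle_dual_integral y i : in_prod Xs y ->
  (\int[muxi]_s (dual_norm (Ns i) (blk (G y s) i))%:E <= (1 + M i ^+ 2)%:E)%E.
Proof.
move=> Xy.
have mdual : measurable_fun setT (fun s => dual_norm (Ns i) (blk (G y s) i)).
  by apply: (@measurable_dual_oracle _ _ (fun=> y) id).
apply: (@le_trans _ _ (\int[muxi]_s (1 + (dual_norm (Ns i) (blk (G y s) i) ^+ 2)%:E))%E).
  apply: le_integral_pointwise => s; rewrite -EFinD lee_fin.
  by set D := dual_norm _ _; have := sqr_ge0 (D - 2^-1); rewrite sqrrB; lra.
rewrite ge0_integralD//; last 2 first.
  by move=> s _; rewrite lee_fin sqr_ge0.
  by apply/measurable_EFinP; exact: measurable_funX.
rewrite EFinD; apply: leeD; last exact: HM.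
by apply: integral_le_cst.
Qed.

Lemma oracle_dotv_integral y i c : in_prod Xs y ->
  (\int[muxi]_s (dotv (blk (G y s) i) c)%:E)%E = (dotv (blk (g y) i) c)%:E.
Proof.
move=> Xy; rewrite /dotv.
under eq_integral do rewrite -sumEFin.
transitivity (\sum_(l < nb i) \int[muxi]_s ((c 0 l)%:E * (G y s 0 (tagnat.Rank i l))%:E))%E.
  rewrite -integral_sum//; first by apply: eq_integral => s _; apply: eq_bigr => l _;
    rewrite blkE mulrC.
  by move=> l; apply: integrableZl => //; case: (HGunb Xy (tagnat.Rank i l)).
rewrite -sumEFin; apply: eq_bigr => l _.
have [intG EG] := HGunb Xy (tagnat.Rank i l).
by rewrite integralZl// EG -EFinM blkE mulrC.
Qed.

(** * Iterates and their adaptedness to the history *)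

Section Iterates.
Context {d : measure_display} {Omega : measurableType d} (P : probability Omega R).
Context (ik : nat -> Omega -> 'I_b) (xi : nat -> Omega -> Xi).
Hypothesis Hikm : forall k (A : set 'I_b), measurable (ik k @^-1` A).
Hypothesis Hxim : forall k, measurable_fun setT (xi k).
Hypothesis Hunif : forall k i, (1 <= k)%N -> P (ik k @^-1` [set i]) = (b%:R^-1)%:E.
Hypothesis Hlaw : forall k B, (1 <= k)%N -> measurable B ->
  P (xi k @^-1` B) = muxi B.
Hypothesis Hind : indep_family P ik xi.
Context (gam : nat -> R) (gam0 : forall k, 0 < gam k.+1).
Context (x1 : 'rV[R]_n) (Hx1 : in_prod Xs x1) (xs : nat -> Omega -> 'rV[R]_n).
Hypothesis Hxs1 : forall om, xs 1%N om = x1.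
Hypothesis Hrec : forall k om i,
  (i = ik k.+1 om ->
     is_argmin (Xs i)
       (fun u => dotv (blk (G (xs k.+1 om) (xi k.+1 om)) i) u
                 + bregman (ws i) (blk (xs k.+1 om) i) u / gam k.+1)
       (blk (xs k.+2 om) i)) /\
  (i <> ik k.+1 om -> blk (xs k.+2 om) i = blk (xs k.+1 om) i).
Context (x : 'rV[R]_n) (Hx : in_prod Xs x).

Local Notation hist := (history ik xi).

Lemma iterate_in k om : in_prod Xs (xs k.+1 om).
Proof.
elim: k => [|k IH] i; first by rewrite Hxs1.
have [argm same] := Hrec k om i.
by have [/argm[]//|/same ->] := pselect (i = ik k.+1 om).
Qed.

(** Induction on k: on the event i_(k+1) = i, block i is a prox point and [measurable_prox] applies;
    off this event it is copied. The iterate [xs k.+1] uses only steps 1 to k, which leaves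
    (i_(k+1), xi_(k+1)) independent of it. *)
Lemma measurable_iterate k j : measurable_fun [set: hist k] (fun om => xs k.+1 om 0 j).
Proof.
elim: k j => [|k IH] j.
  rewrite (_ : (fun _ => _) = cst (x1 0 j)) //.
  by apply/funext => om; rewrite Hxs1.
have IH' l : measurable_fun [set: hist k.+1] (fun om => xs k.+1 om 0 l).
  exact: (measurableT_comp (IH l) (@measurable_historyS _ _ _ _ _ ik xi k)).
pose i := tagnat.sig1 j; pose l := tagnat.sig2 j.
pose D : set (hist k.+1) := ik k.+1 @^-1` [set i].
have mD : measurable D by exact: measurable_history_ik.
rewrite (_ : (fun _ => _) = fun om => blk (xs k.+2 om) i 0 l); last first.
  by apply/funext => om; rewrite coord_blk.
rewrite -(setUv D); apply/measurable_funU => //; first exact: measurableC.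
split.
  apply: (@measurable_prox _ (hist k.+1) (xs k.+1) (xi k.+1) _ _ _ (gam k.+1) _ i D mD
    (fun om => blk (xs k.+2 om) i)) => //.
  - exact: measurable_history_xi.
  - by move=> om; exact: iterate_in.
  - by move=> om Dom; apply: (Hrec k om i).1; rewrite -Dom.
pose h (om : hist k.+1) : R := blk (xs k.+1 om) i 0 l.
apply: (eq_measurable_fun h).
  move=> om; rewrite inE => Dom; rewrite /h (Hrec k om i).2// => iE.
  by apply: Dom; rewrite /D /= -iE.
by apply: measurable_funTS; exact: measurable_blk.
Qed.

Lemma measurable_iterate_Omega k j : measurable_fun setT (fun om => xs k.+1 om 0 j).
Proof.
have mid : measurable_fun [set: Omega] (id : Omega -> hist k).
  exact: measurable_history_id.
exact: (measurableT_comp (@measurable_iterate k j) mid).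
Qed.

(** * Means of the oracle terms at one step *)

Section Step.
Context (k : nat) (i : 'I_b).
Local Notation D := (ik k.+1 @^-1` [set i]).

Let mD : measurable D. Proof. exact: Hikm. Qed.

Let bpos : 0 < b%:R :> R. Proof. by rewrite ltr0n. Qed.

Let indepD (A : set (hist k)) (B : set Xi) : measurable A -> measurable B ->
  (b%:R%:E * P (D `&` (id @^-1` A `&` xi k.+1 @^-1` B)) =
   P (id @^-1` A) * muxi B)%E.
Proof. by move=> mA mB; exact: history_indep. Qed.

Let mid : measurable_fun [set: Omega] (id : Omega -> hist k).
Proof. exact: measurable_history_id. Qed.

(** Oracle terms become functions of a pair (history, sample), to be evaluated at the history and
    xi_(k+1). *)
Let Xp (z : hist k * Xi) := xs k.+1 z.1.
Let Yp (z : hist k * Xi) := z.2.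

Let mXp j : measurable_fun setT (fun z => Xp z 0 j).
Proof. exact: (measurableT_comp (@measurable_iterate k j) measurable_fst). Qed.

Let mYp : measurable_fun setT Yp. Proof. exact: measurable_snd. Qed.

Let inXp z : in_prod Xs (Xp z). Proof. exact: iterate_in. Qed.

Definition dual_oracle om := dual_norm (Ns i) (blk (G (xs k.+1 om) (xi k.+1 om)) i).

Definition dotv_oracle om :=
  dotv (blk (G (xs k.+1 om) (xi k.+1 om)) i) (blk (x - xs k.+1 om) i).

Definition dotv_mean om := dotv (blk (g (xs k.+1 om)) i) (blk (x - xs k.+1 om) i).

Lemma integrable_dual_oracle : P.-integrable D (EFin \o dual_oracle).
Proof.
apply: (integrable_indep mid (Hxim k.+1) mD (ltW bpos) indepD bpos
  (f := fun z : hist k * Xi => (dual_norm (Ns i) (blk (G (Xp z) (Yp z)) i))%:E)).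
  by apply/measurable_EFinP; exact: measurable_dual_oracle.
apply: (@le_lt_trans _ _ (1 + M i ^+ 2)%:E); last exact: ltry.
apply: integral_le_cst => om; apply: le_trans (oracle_dual_integral i (iterate_in k om)).
by apply: le_integral_pointwise => s; rewrite gee0_abs// lee_fin dual_norm_ge0.
Qed.

Lemma dual_oracle_sqr :
  P.-integrable D (fun om => (dual_oracle om ^+ 2)%:E) /\
  (b%:R%:E * \int[P]_(om in D) (dual_oracle om ^+ 2)%:E <= (M i ^+ 2)%:E)%E.
Proof.
pose f (z : hist k * Xi) := ((dual_norm (Ns i) (blk (G (Xp z) (Yp z)) i)) ^+ 2)%:E.
have mf : measurable_fun setT f.
  by apply/measurable_EFinP; apply: measurable_funX; exact: measurable_dual_oracle.
have f0 z : (0 <= f z)%E by rewrite lee_fin sqr_ge0.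
have le_f om : (\int[muxi]_s f (om, s) <= (M i ^+ 2)%:E)%E by exact: HM (iterate_in k om) i.
split.
  apply: (integrable_indep mid (Hxim k.+1) mD (ltW bpos) indepD bpos mf).
  apply: (@le_lt_trans _ _ (M i ^+ 2)%:E); last exact: ltry.
  apply: integral_le_cst => om; apply: le_trans (le_f om).
  by apply: le_integral_pointwise => s; rewrite gee0_abs.
rewrite (ge0_integral_indep mid (Hxim k.+1) mD (ltW bpos) indepD mf f0).
exact: integral_le_cst.
Qed.

(** The pairing is dominated by the dual norm of G_i times the distance of x_k to x in block i. Its
    mean over the sample is at most 1 + M_i^2 times that distance, whose integrability therefore
    justifies Fubini; the inner integral turns G into g. *)
Lemma dotv_oracle_mean :
  P.-integrable setT (fun om => (Ns i (blk (x - xs k.+1 om) i))%:E) ->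
  [/\ P.-integrable D (EFin \o dotv_oracle), P.-integrable setT (EFin \o dotv_mean) &
  (b%:R%:E * \int[P]_(om in D) (dotv_oracle om)%:E = \int[P]_om (dotv_mean om)%:E)%E].
Proof.
move=> intN.
pose f (z : hist k * Xi) := (dotv (blk (G (Xp z) (Yp z)) i) (blk (x - Xp z) i))%:E.
have mf : measurable_fun setT f.
  by apply/measurable_EFinP; exact: measurable_dotv_oracle.
have foo : (\int[P]_om \int[muxi]_s `|f (om, s)| < +oo)%E.
  apply: (@le_lt_trans _ _
    (\int[P]_om ((1 + M i ^+ 2)%:E * (Ns i (blk (x - xs k.+1 om) i))%:E))%E); last first.
    rewrite integralZl// lte_mul_pinfty// ?lee_fin ?addr_ge0 ?sqr_ge0//.
    by have /integrable_lty := intN; apply.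
  apply: le_integral_pointwise => om.
  set c := Ns i _; have c0 : 0 <= c by exact: is_norm_ge0.
  apply: (@le_trans _ _
    (\int[muxi]_s (c%:E * (dual_norm (Ns i) (blk (G (xs k.+1 om) s) i))%:E))%E).
    apply: le_integral_pointwise => s; rewrite /f /= lee_fin mulrC.
    exact: dotv_dual_norm.
  rewrite ge0_integralZl_EFin//; last 2 first.
    by move=> s _; rewrite lee_fin dual_norm_ge0.
    apply/measurable_EFinP.
    by apply: (@measurable_dual_oracle _ _ (fun=> xs k.+1 om) id) => // t; exact: iterate_in.
  rewrite muleC lee_wpmul2r ?lee_fin//; exact: oracle_dual_integral (iterate_in k om).
have fE om : (\int[muxi]_s f (om, s) = (dotv_mean om)%:E)%E.
  by exact: (@oracle_dotv_integral (xs k.+1 om) i (blk (x - xs k.+1 om) i) (iterate_in k om)).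
have [E intF] := integral_indep mid (Hxim k.+1) mD (ltW bpos) indepD bpos mf foo.
split.
- exact: (integrable_indep mid (Hxim k.+1) mD (ltW bpos) indepD bpos mf foo).
- by rewrite (_ : EFin \o _ = fun om => \int[muxi]_s f (om, s))%E//; apply/funext.
- by rewrite E; apply: eq_integral => om _; exact: fE.
Qed.

End Step.

(** By [prox_move], a step increases the distance to x in block i by at most gamma times the dual
    norm of G_i, and only on the event that i is drawn. That quantity is integrable by
    [integrable_dual_oracle], which assumes nothing on the distance, so there is no circularity. *)
Lemma integrable_iterate k i :
  P.-integrable setT (fun om => (Ns i (blk (x - xs k.+1 om) i))%:E).
Proof.
elim: k => [|k IH].
  rewrite (_ : (fun _ => _) = EFin \o cst (Ns i (blk (x - x1) i))).
    exact: finite_measure_integrable_cst.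
  by apply/funext => om; rewrite Hxs1.
pose D := ik k.+1 @^-1` [set i].
have mD : measurable D by exact: Hikm.
have /(integrable_mkcond _ mD) := integrable_dual_oracle k i.
rewrite -/D restrict_EFin => iD.
have iG := integrableD measurableT IH (integrableZl measurableT (gam k.+1) iD).
apply: le_integrable iG => //.
  apply/measurable_EFinP; apply: measurable_norm_blk => j.
  exact: (@measurable_iterate_Omega k.+1 j).
move=> om _ /=; rewrite lee_fin (ger0_norm (is_norm_ge0 (HNs i) _)).
apply: le_trans (ler_norm _).
rewrite patchE; have [argm same] := Hrec k om i.
have -> : blk (x - xs k.+2 om) i =
    blk (x - xs k.+1 om) i + (blk (xs k.+1 om) i - blk (xs k.+2 om) i).
  by rewrite !blkB subrKA.
case: ifPn => [/set_mem Dom|/negP Dom].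
  have pr := prox_move (HNs i) (@vXs i) (w1 i) (@wsc i) (gam0 k) (iterate_in k om i)
    (argm (esym Dom)).
  by apply: le_trans (is_normD (HNs i) _ _) _; rewrite lerD2l.
rewrite same ?subrr ?addr0 ?mulr0 ?addr0// => iE.
by apply: Dom; apply/mem_set; rewrite /D /= -iE.
Qed.

(** The first term is centred, since b times the indicator of i_(k+1) = i has mean 1 given the past;
    the second carries the second moment of the oracle. *)
Definition step_noise k i om :=
  let D := ik k.+1 @^-1` [set i] in
  gam k.+1 * (b%:R * (dotv_oracle k i \_ D) om - dotv_mean k i om) +
  gam k.+1 ^+ 2 / 2 * (b%:R * ((fun om => dual_oracle k i om ^+ 2) \_ D) om).

Lemma step_noise_mean k i :
  mean_le P (step_noise k i) (gam k.+1 ^+ 2 / 2 * M i ^+ 2).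
Proof.
pose D := ik k.+1 @^-1` [set i].
have mD : measurable D by exact: Hikm.
have [iA iB AB] := dotv_oracle_mean (integrable_iterate k i).
have [iC C] := dual_oracle_sqr k i.
move: iA => /(integrable_mkcond _ mD); rewrite restrict_EFin => iA.
move: iC => /(integrable_mkcond _ mD).
rewrite (restrict_EFin (fun om => dual_oracle k i om ^+ 2)) => iC.
(* The bound is split as gamma times 0 for the centred term plus the second moment bound. *)
rewrite -[X in mean_le _ _ X]add0r -[X in X + _](mulr0 (gam k.+1)).
apply: mean_leD; apply: mean_leZ; rewrite ?(ltW (gam0 k)) ?divr_ge0 ?sqr_ge0//; last first.
  split.
    pose h : Omega -> R := (fun om => dual_oracle k i om ^+ 2) \_ D.
    rewrite (_ : EFin \o _ = fun t => (b%:R%:E * (EFin \o h) t)%E)//.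
    exact: integrableZl.
  under eq_integral do rewrite EFinM.
  rewrite integralZl//; apply: le_trans C.
  by rewrite [in leRHS]integral_mkcond (restrict_EFin (fun om => dual_oracle k i om ^+ 2)).
pose h om : R := b%:R * (dotv_oracle k i \_ D) om.
have ibA : P.-integrable setT (EFin \o h).
  rewrite (_ : EFin \o _ = fun t => (b%:R%:E * (EFin \o (dotv_oracle k i \_ D)) t)%E)//.
  exact: integrableZl.
split.
  rewrite (_ : EFin \o _ = (EFin \o h) \- (EFin \o dotv_mean k i))%E//.
  exact: integrableB.
under eq_integral do rewrite EFinB.
(* The mean of [dotv_mean] becomes b times the integral of [dotv_oracle] over [D], which cancels the
   first integral. *)
rewrite (integralB_EFin measurableT ibA iB) -AB; under eq_integral do rewrite EFinM.
rewrite integralZl// [X in (_ - _ * X)%E]integral_mkcond.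
rewrite (restrict_EFin (dotv_oracle k i)) subee// fin_numM//.
exact: integrable_fin_num.
Qed.

(** * Decrease of the potential and telescoping *)

Context (f : 'rV[R]_n -> R) (mu Q : R) (mu0 : 0 < mu) (Q0 : 0 < Q).
Hypothesis Hsc : forall x y, in_prod Xs x -> in_prod Xs y ->
  f x + dotv (g x) (y - x) + mu / 2 * blk_norm2 Ns (y - x) <= f y.
Hypothesis HVQ : forall i z x, Xs i z -> Xs i x ->
  bregman (ws i) z x <= Q / 2 * Ns i (z - x) ^+ 2.

(** The index is shifted: [potential k] is taken at [xs k.+1], so that [potential 0] is the
    deterministic value at x_1. *)
Definition potential k om := \sum_i bregman (ws i) (blk (xs k.+1 om) i) (blk x i).

Lemma potential_ge0 k om : 0 <= potential k om.
Proof.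
apply: sumr_ge0 => i _.
by apply: (bregman_ge0 (HNs i) (w1 i) (@wsc i)); [exact: iterate_in|exact: Hx].
Qed.

(** Proved block by block. On the drawn block this is b times the prox descent; on the others V_i is
    unchanged and the indicators vanish. The pairings with g cancel between the noise and the linear
    term. *)
Lemma potential_step k om :
  b%:R * potential k.+1 om <= b%:R * potential k om +
    (\sum_i step_noise k i om + gam k.+1 * dotv (g (xs k.+1 om)) (x - xs k.+1 om)).
Proof.
rewrite dotv_blk !mulr_sumr -!big_split /=; apply: ler_sum => i _.
rewrite /step_noise -/(dotv_mean k i om) !patchE.
have bge0 : 0 <= b%:R :> R by [].
have [argm same] := Hrec k om i.
case: ifPn => [/set_mem Dom|/negP Dom].
  have := prox_descent (HNs i) (@vXs i) (w1 i) (@wsc i) (gam0 k) (iterate_in k om i)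
    (Hx i) (argm (esym Dom)).
  rewrite -blkB -/(dotv_oracle k i om) -/(dual_oracle k i om) => /(ler_wpM2l bge0).
  by move: (bregman _ _ _) (bregman _ _ _) (dotv_oracle _ _ _) (dotv_mean _ _ _) => *; lra.
rewrite same; last by move=> iE; apply: Dom; apply/mem_set; rewrite /= -iE.
(* Outside its set a restricted function takes the default value [point]. *)
have -> : point = 0 :> R by [].
by move: (bregman _ _ _) (dotv_mean _ _ _) => *; lra.
Qed.

(** Strong convexity at x_k bounds <g(x_k), x - x_k>; its quadratic term dominates (mu / Q) times
    the potential because V_i is at most Q / 2 times the squared norm. *)
Lemma descent k om :
  gam k.+1 * (f (xs k.+1 om) - f x) <=
    (b%:R - gam k.+1 * mu / Q) * potential k om - b%:R * potential k.+1 om +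
    \sum_i step_noise k i om.
Proof.
have := potential_step k om; have := Hsc (iterate_in k om) Hx.
have : potential k om <= Q / 2 * blk_norm2 Ns (x - xs k.+1 om).
  rewrite /blk_norm2 mulr_sumr; apply: ler_sum => i _.
  by rewrite blkB (is_norm_distC (HNs i)); apply: HVQ; [exact: iterate_in|exact: Hx].
move: (potential k om) (potential k.+1 om) (blk_norm2 _ _) (dotv _ _) (f x) (f _).
move=> p p' N2 e fx fk pN sc st.
have h1 : gam k.+1 * mu / Q * p <= gam k.+1 * (mu / 2 * N2).
  have -> : gam k.+1 * (mu / 2 * N2) = gam k.+1 * mu / Q * (Q / 2 * N2).
    by field; rewrite gt_eqF.
  by rewrite ler_wpM2l// !mulr_ge0 ?invr_ge0// ltW.
have := ler_wpM2l (ltW (gam0 k)) sc; lra.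
Qed.

Local Notation Gamma := (Gam (mu / (b%:R * Q)) gam).
Hypothesis gam_le : forall k, gam k.+1 <= b%:R * Q / mu.

Lemma GammaS k : Gamma k.+2 = Gamma k.+1 * (1 - gam k.+2 * (mu / (b%:R * Q))).
Proof. by []. Qed.

Lemma Gamma_factor_ge0 k : 0 <= 1 - gam k.+1 * (mu / (b%:R * Q)).
Proof.
have bQ : 0 < b%:R * Q by rewrite mulr_gt0// ltr0n.
by rewrite subr_ge0 mulrA ler_pdivrMr// mul1r -ler_pdivlMr.
Qed.

Lemma Gamma_ge0 k : 0 <= Gamma k.+1.
Proof.
by elim: k => [|k IH]; [exact: ler01|rewrite GammaS mulr_ge0// Gamma_factor_ge0].
Qed.

(* Once [Gamma] vanishes the later weights are [gam / 0 = 0], so these steps are void. *)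
Lemma telescope N om :
  \sum_(k < N.+1) gam k.+1 / Gamma k.+1 * (f (xs k.+1 om) - f x) <=
    (b%:R - gam 1%N * mu / Q) * potential 0 om
    - b%:R * potential N.+1 om / Gamma N.+1
    + \sum_(k < N.+1) (Gamma k.+1)^-1 * \sum_i step_noise k i om.
Proof.
elim: N => [|N IH].
  rewrite !big_ord1 [Gamma 1]/= invr1 mul1r !mulr1; exact: descent.
rewrite big_ord_recr [X in _ <= _ + X]big_ord_recr /= -/(Gamma N.+2).
have := potential_ge0 N.+1 om; have := potential_ge0 N.+2 om.
have bge0 : 0 <= b%:R :> R by [].
move: (potential 0 om) IH (descent N.+1 om) => p0.
move: (potential N.+1 om) (potential N.+2 om) (f _ - f x) => p p' F.
move: (\sum_i _) (\sum_(k < N.+1) _) (\sum_(k < N.+1) _) => z s s'.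
move=> IH de p'0 pge.
(* In this case the new terms are all 0, and the potential subtracted at the previous step is
   discarded as nonnegative. *)
have [G0|G0] := eqVneq (Gamma N.+2) 0.
  rewrite G0 invr0 !mulr0 mul0r mul0r addr0 subr0 addr0; apply: le_trans IH _.
  rewrite lerD2r gerBl; apply: mulr_ge0; first exact: mulr_ge0.
  by rewrite invr_ge0 Gamma_ge0.
have Gp : 0 < Gamma N.+2 by rewrite lt_neqAle eq_sym G0 Gamma_ge0.
have G1 : Gamma N.+1 != 0 by apply: contraNneq G0; rewrite GammaS => ->; rewrite mul0r.
have G2 : 1 - gam N.+2 * (mu / (b%:R * Q)) != 0.
  by apply: contraNneq G0; rewrite GammaS => ->; rewrite mulr0.
have b00 : b%:R != 0 :> R by rewrite pnatr_eq0 -lt0n.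
(* The coefficient is b times the factor by which [Gamma] shrinks, so the potential added at this
   step is exactly the one subtracted at the previous step. *)
have E : (b%:R - gam N.+2 * mu / Q) * p * (Gamma N.+2)^-1 = b%:R * p / Gamma N.+1.
  have -> : b%:R - gam N.+2 * mu / Q = b%:R * (1 - gam N.+2 * (mu / (b%:R * Q))).
    by field; rewrite b00 gt_eqF.
  have alg (c q B : R) : q != 0 -> c != 0 -> B * c * p / (q * c) = B * p / q.
    by move=> q0 c0; field; apply/andP.
  by rewrite GammaS alg.
have : 0 <= (Gamma N.+2)^-1 by rewrite invr_ge0 ltW.
move=> /ler_wpM2r /(_ _ _ de); rewrite mulrDl mulrBl E.
move: IH; move: ((Gamma N.+2)^-1) => q; move: (b%:R * p / _) => B.
lra.
Qed.

(** * Passage to the averaged iterate *)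

Hypothesis Hfconv : convex_on (in_prod Xs) f.

Lemma convex_in_prod : is_convex_set (in_prod Xs).
Proof. by move=> u v t Xu Xv t01 i; rewrite blkD !blkZ; exact: vXs. Qed.

(** The estimate is split into a majorant of the gap valid at every [om] and a bound on the mean of
    this majorant, so that only the majorant has to be integrable. *)
Lemma expected_gap N :
  let theta k := gam k / Gamma k in
  let S := \sum_(k < N.+1) theta k.+1 in
  mean_le P
    (fun om => S^-1 * ((b%:R - gam 1%N * mu / Q) * potential 0 om +
      \sum_(k < N.+1) (Gamma k.+1)^-1 * \sum_i step_noise k i om))
    (S^-1 * ((b%:R - gam 1%N * mu / Q) * (\sum_i bregman (ws i) (blk x1 i) (blk x i)) +
      2^-1 * \sum_(k < N.+1) gam k.+1 * theta k.+1 * \sum_i M i ^+ 2)) /\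
  forall om, f (S^-1 *: \sum_(k < N.+1) theta k.+1 *: xs k.+1 om) - f x <=
    S^-1 * ((b%:R - gam 1%N * mu / Q) * potential 0 om +
      \sum_(k < N.+1) (Gamma k.+1)^-1 * \sum_i step_noise k i om).
Proof.
move=> theta S.
have theta_ge0 k : 0 <= theta k.+1 by rewrite divr_ge0 ?Gamma_ge0// ltW.
have theta1 : 0 < theta 1%N by rewrite /theta /= invr1 mulr1.
have S0 : 0 < S by rewrite /S big_ord_recl ltr_pwDl// sumr_ge0.
split.
  apply: mean_leZ; first by rewrite invr_ge0 ltW.
  apply: mean_leD.
    rewrite (_ : (fun _ => _) = fun=> (b%:R - gam 1%N * mu / Q) *
      \sum_i bregman (ws i) (blk x1 i) (blk x i)); first exact: mean_le_cst.
    apply/funext => om; congr (_ * _); apply: eq_bigr => i _.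
    by rewrite Hxs1.
  rewrite mulr_sumr; apply: mean_le_sum => k.
  (* By the definition of theta, gamma_k theta_k = gamma_k^2 / Gamma_k, the noise bound with its
     weight. *)
  rewrite (_ : 2^-1 * _ = (Gamma k.+1)^-1 * \sum_i gam k.+1 ^+ 2 / 2 * M i ^+ 2).
    apply: mean_leZ; first by rewrite invr_ge0 Gamma_ge0.
    by apply: mean_le_sum => i; exact: step_noise_mean.
  by rewrite -mulr_sumr /theta; move: (\sum_i _) (_^-1) => *; ring.
move=> om; have [_ le_avg] := @convex_on_sum R n (in_prod Xs) f (fun k => theta k.+1)
  (fun k => xs k.+1 om) N convex_in_prod Hfconv (fun k => iterate_in k om) theta1 theta_ge0.
apply: le_trans (lerB le_avg (lexx _)) _.
rewrite -/S; have -> : f x = S^-1 * (S * f x) by rewrite mulrA mulVf ?mul1r// gt_eqF.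
rewrite -mulrBr ler_wpM2l ?invr_ge0 ?(ltW S0)//.
rewrite [X in _ - X]mulr_suml -sumrB.
under eq_bigr do rewrite -mulrBr.
apply: le_trans (telescope N om) _.
(* The final potential enters with a minus sign and is dropped. *)
rewrite lerD2r gerBl; apply: divr_ge0; last exact: Gamma_ge0.
by apply: mulr_ge0 => //; exact: potential_ge0.
Qed.

End Iterates.

End SBMD.

Unset Implicit Arguments.

Theorem theorem2p4
  (R : realType) (b : nat) (hb : (0 < b)%N) (nb : 'I_b -> nat)
  (* block norms *)
  (Ns : forall i : 'I_b, 'rV[R]_(nb i) -> R)
  (HNs : forall i, is_norm (Ns i))
  (* feasible sets X_i: nonempty, closed, convex *)
  (Xs : forall i : 'I_b, set 'rV[R]_(nb i))
  (HXs : forall i, [/\ Xs i !=set0, closed (Xs i) & is_convex_set (Xs i)])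
  (* distance generating functions omega_i *)
  (ws : forall i : 'I_b, 'rV[R]_(nb i) -> R)
  (Hws : forall i, C1_on (Xs i) (ws i) /\ strongly_convex_on (Xs i) (Ns i) 1 (ws i))
  (* random data xi with law muxi, objective f(x) = E[F(x, xi)] *)
  (dX : measure_display) (Xi : measurableType dX) (muxi : probability Xi R)
  (F : 'rV[R]_(\sum_(i < b) nb i) -> Xi -> R)
  (f : 'rV[R]_(\sum_(i < b) nb i) -> R)
  (HF : forall x, in_prod Xs x ->
     muxi.-integrable setT (fun s => (F x s)%:E) /\
     (f x)%:E = (\int[muxi]_s (F x s)%:E)%E)
  (Hfconv : convex_on (in_prod Xs) f)
  (* stochastic oracle G, with E[G(x,xi)] = g(x) in the subdifferential of f *)
  (G : 'rV[R]_(\sum_(i < b) nb i) -> Xi -> 'rV[R]_(\sum_(i < b) nb i))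
  (g : 'rV[R]_(\sum_(i < b) nb i) -> 'rV[R]_(\sum_(i < b) nb i))
  (Hsubg : forall x y, in_prod Xs x -> in_prod Xs y ->
     f x + dotv (g x) (y - x) <= f y)
  (HGmeas : forall j, measurable_fun
     [set p : (\sum_(i < b) nb i).-tuple R * Xi | in_prod Xs (row_of_tuple p.1)]
     (fun p => G (row_of_tuple p.1) p.2 0 j))
  (HGunb : forall x, in_prod Xs x -> forall j,
     muxi.-integrable setT (fun s => (G x s 0 j)%:E) /\
     (\int[muxi]_s (G x s 0 j)%:E)%E = (g x 0 j)%:E)
  (M : 'I_b -> R)
  (HM : forall x, in_prod Xs x -> forall i,
     (\int[muxi]_s ((dual_norm (Ns i) (blk (G x s) i)) ^+ 2)%:E <= (M i ^+ 2)%:E)%E)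
  (* strong convexity of f with modulus mu *)
  (mu : R) (Hmu : 0 < mu)
  (Hsc : forall x y, in_prod Xs x -> in_prod Xs y ->
     f x + dotv (g x) (y - x) + mu / 2 * blk_norm2 Ns (y - x) <= f y)
  (* V_i(z,x) <= Q/2 ||z - x||_i^2 *)
  (Q : R) (HQ : 0 < Q)
  (HVQ : forall i z x, Xs i z -> Xs i x ->
     bregman (ws i) z x <= Q / 2 * Ns i (z - x) ^+ 2)
  (* stepsizes *)
  (gam : nat -> R)
  (Hgam : forall k, (1 <= k)%N -> 0 < gam k /\ gam k <= b%:R * Q / mu)
  (* probability space carrying the random indices i_k and samples xi_k *)
  (d : measure_display) (Omega : measurableType d) (P : probability Omega R)
  (ik : nat -> Omega -> 'I_b) (xi : nat -> Omega -> Xi)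
  (Hikm : forall k (A : set 'I_b), measurable (ik k @^-1` A))
  (Hxim : forall k, measurable_fun setT (xi k))
  (Hunif : forall k i, (1 <= k)%N -> P (ik k @^-1` [set i]) = (b%:R^-1)%:E)
  (Hlaw : forall k B, (1 <= k)%N -> measurable B -> P (xi k @^-1` B) = muxi B)
  (Hind : indep_family P ik xi)
  (* SBMD iterates *)
  (x1 : 'rV[R]_(\sum_(i < b) nb i)) (Hx1 : in_prod Xs x1)
  (xs : nat -> Omega -> 'rV[R]_(\sum_(i < b) nb i))
  (Hxs1 : forall om, xs 1%N om = x1)
  (Hrec : forall k om i, (1 <= k)%N ->
     (i = ik k om ->
        is_argmin (Xs i)
          (fun u => dotv (blk (G (xs k om) (xi k om)) i) u
                    + bregman (ws i) (blk (xs k om) i) u / gam k)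
          (blk (xs k.+1 om) i)) /\
     (i <> ik k om -> blk (xs k.+1 om) i = blk (xs k om) i))
  (N : nat) (HN : (1 <= N)%N)
  (x : 'rV[R]_(\sum_(i < b) nb i)) (Hx : in_prod Xs x) :
  let theta := fun k => gam k / Gam (mu / (b%:R * Q)) gam k in
  let xbar := fun om => (\sum_(1 <= k < N.+1) theta k)^-1 *:
                          \sum_(1 <= k < N.+1) theta k *: xs k om in
  ('E_P[fun om => (f (xbar om) - f x)%R]
   <= ((\sum_(1 <= k < N.+1) theta k)^-1 *
       ((b%:R - gam 1%N * mu / Q) *
          \sum_(i < b) bregman (ws i) (blk x1 i) (blk x i)
        + 2^-1 * \sum_(1 <= k < N.+1) gam k * theta k * \sum_(i < b) M i ^+ 2))%:E)%E.
Proof.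
cbv zeta.
have gam0 k : 0 < gam k.+1 by case: (Hgam k.+1).
have gam_le k : gam k.+1 <= b%:R * Q / mu by case: (Hgam k.+1).
case: N HN => // m _.
have cXs i : closed (Xs i) by case: (HXs i).
have vXs i : is_convex_set (Xs i) by case: (HXs i).
have w1 i : C1_on (Xs i) (ws i) by case: (Hws i).
have wsc i : strongly_convex_on (Xs i) (Ns i) 1 (ws i) by case: (Hws i).
have Hrec' k om i := Hrec k.+1 om i isT.
have [[_ mean] gap] := expected_gap hb HNs cXs vXs w1 wsc HGmeas HGunb HM
  Hikm Hxim Hunif Hlaw Hind gam0 Hx1 Hxs1 Hrec' Hx Hmu HQ Hsc HVQ gam_le Hfconv m.
(* The expectation unfolds to an integral, which is monotone for pointwise inequalities even when
   the gap is not measurable. *)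
rewrite unlock; apply: le_trans (le_integral_pointwise P (g := _) _) _; last first.
  rewrite !big_add1 !big_mkord; exact: mean.
move=> om; rewrite lee_fin !big_add1 !big_mkord; exact: gap.
Qed.
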